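(* Let $k$ be any field, let $n$ and $d$ be integers with $n \geq 2d$ and $d \geq 1$, and let $G = C_n(1,2,\ldots,d)$. Then $G$ is Buchsbaum (over $k$) but not Cohen-Macaulay (over $k$) if and only if $n = 2d+2$ or $n = 4d+3$.
   Context: Circulant graphs: given an integer $n \geq 1$ and $S \subseteq \{1,2,\ldots,\lfloor n/2 \rfloor\}$, the circulant graph $C_n(S)$ is the finite simple graph on vertices $\{x_1,\ldots,x_n\}$ such that $\{x_i,x_j\}$ (with $i \ne j$) is an edge if and only if $\min\{|i-j|,\, n-|i-j|\} \in S$. The set brackets are suppressed, so $C_n(1,2,\ldots,d) = C_n(\{1,2,\ldots,d\})$. Simplicial complexes: faces include $\emptyset$; $\dim F = |F|-1$; $\dim\Delta$ is the maximum dimension of a face; $\Delta$ is pure if all its facets (maximal faces) have the same dimension. For $F \in \Delta$, $\mathrm{link}_\Delta(F) = \{H \in \Delta : F \cap H = \emptyset,\ F \cup H \in \Delta\}$. $\tilde{H}_i(\Delta;k)$ denotes the $i$th reduced simplicial homology of $\Delta$ with coefficients in $k$ (computed from the augmented chain complex with the face $\emptyset$ in degree $-1$). Independence complex: for a finite simple graph $G$, $\mathrm{Ind}(G)$ is the simplicial complex of all independent sets of vertices of $G$ (sets containing no edge of $G$). Buchsbaum: a pure simplicial complex $\Delta$ is Buchsbaum over $k$ if for every non-empty face $F \in \Delta$, $\tilde{H}_i(\mathrm{link}_\Delta(F);k) = 0$ for all $i < \dim \mathrm{link}_\Delta(F)$. A graph $G$ is Buchsbaum if $\mathrm{Ind}(G)$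 is Buchsbaum (in particular pure). Cohen-Macaulay graphs: for a graph $G$ on $\{x_1,\ldots,x_n\}$, let $R = k[x_1,\ldots,x_n]$ and let $I(G) = \langle x_ix_j : \{x_i,x_j\} \text{ is an edge of } G\rangle$ be the edge ideal. $G$ is Cohen-Macaulay if $R/I(G)$ is a Cohen-Macaulay ring, i.e. its Krull dimension equals its depth, where depth is the length of the longest regular sequence on $R/I(G)$ in $\langle x_1,\ldots,x_n\rangle$. *)

(* Defs.v *)
From HB Require Import structures.
From mathcomp Require Import all_boot all_order all_algebra.
From mathcomp Require Import generic_quotient ring_quotient boolp mpoly.

Set Implicit Arguments.
Unset Strict Implicit.
Unset Printing Implicit Defensive.

Import Order.TTheory GRing.Theory Num.Theory.

Local Open Scope ring_scope.
Local Open Scope quotient_scope.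

Record sgraph (n : nat) := SGraph {
  edge :> rel 'I_n;
  edge_sym : ssrbool.symmetric edge;
  edge_irr : irreflexive edge
}.

(* The vertex x_i of the mathematical text is i.-1 : 'I_n. *)
Section Circulant.
Variables (n : nat) (S : seq nat).

Definition absdiff (i j : nat) : nat := (maxn i j - minn i j)%N.

Definition circulant_rel : rel 'I_n :=
  fun i j => (i != j) && (minn (absdiff i j) (n - absdiff i j) \in S).

Fact circulant_sym : ssrbool.symmetric circulant_rel.
Proof.
by move=> i j; rewrite /circulant_rel /absdiff eq_sym maxnC [minn i j]minnC.
Qed.

Fact circulant_irr : irreflexive circulant_rel.
Proof. by move=> i; rewrite /circulant_rel eqxx. Qed.

Definition circulant : sgraph n := SGraph circulant_sym circulant_irr.
End Circulant.

Section Complexes.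
Variable n : nat.
Implicit Types (Delta : {set {set 'I_n}}) (F : {set 'I_n}).

Definition is_complex Delta : Prop :=
  set0 \in Delta /\
  (forall F H : {set 'I_n}, F \in Delta -> H \subset F -> H \in Delta).

Definition face_dim F : int := #|F|%:Z - 1.

Definition complex_dim Delta : int := (\max_(F in Delta) #|F|)%N%:Z - 1.

Definition facet Delta F : bool := maxset (mem Delta) F.

Definition pure Delta : Prop :=
  forall F H, facet Delta F -> facet Delta H -> face_dim F = face_dim H.

Definition link Delta F : {set {set 'I_n}} :=
  [set H in Delta | [disjoint F & H] && (F :|: H \in Delta)].

Fact link_complex Delta F :
  is_complex Delta -> F \in Delta -> is_complex (link Delta F).
Proof.
case=> D0 DS FD; split=> [|H K].
  by rewrite inE D0 setU0 FD andbT disjoint_sym disjoints_subset sub0set.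
rewrite !inE => /and3P[HD dFH FHD] KH; apply/and3P; split.
- exact: DS HD KH.
- exact: disjointWr KH dFH.
- by apply: DS FHD _; apply: setUS.
Qed.
End Complexes.

Definition Ind (n : nat) (G : sgraph n) : {set {set 'I_n}} :=
  [set A : {set 'I_n} | [forall x in A, forall y in A, ~~ G x y]].

Fact Ind_complex n (G : sgraph n) : is_complex (Ind G).
Proof.
split=> [|F H]; rewrite !inE.
  by apply/forall_inP => x; rewrite inE.
move=> /forall_inP FI /subsetP HF; apply/forall_inP => x xH.
apply/forall_inP => y yH; have /forall_inP := FI x (HF x xH).
by apply; apply: HF.
Qed.

(* All chains live in one space, the functions on subsets of 'I_n; the subset F
   with its vertices in increasing order is the basis vector [face_vec F].  The
   empty face sits in degree -1, so the complex is the augmented one. *)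
Section Homology.
Variables (k : fieldType) (n : nat).

Definition chain_space := {ffun {set 'I_n} -> k^o}.

Definition face_vec (F : {set 'I_n}) : chain_space := [ffun H => (H == F)%:R].

Definition face_boundary (F : {set 'I_n}) : chain_space :=
  \sum_(x in F) (-1) ^+ #|[set y in F | (y < x)%N]| *: face_vec (F :\ x).

Definition boundary_fun (c : chain_space) : chain_space :=
  \sum_(F : {set 'I_n}) (c F : k) *: face_boundary F.

Fact boundary_fun_linear : linear boundary_fun.
Proof.
move=> a u v; rewrite /boundary_fun scaler_sumr -big_split /=.
by apply: eq_bigr => F _; rewrite !ffunE scalerDl scalerA.
Qed.

HB.instance Definition _ :=
  GRing.isLinear.Build k chain_space chain_space _ boundary_fun
    boundary_fun_linear.

Definition boundary : 'End(chain_space) := linfun boundary_fun.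

Variable Delta : {set {set 'I_n}}.

Definition chains (i : int) : {vspace chain_space} :=
  <<[seq face_vec F | F <- enum Delta & face_dim F == i]>>%VS.

Definition cycles (i : int) : {vspace chain_space} :=
  (lker boundary :&: chains i)%VS.

Definition boundaries (i : int) : {vspace chain_space} :=
  (boundary @: chains (i + 1))%VS.

(* The quotient cycles/boundaries, realised inside the chains as a complement
   of the boundaries in the cycles. *)
Definition reduced_homology (i : int) : {vspace chain_space} :=
  (cycles i :\: boundaries i)%VS.
End Homology.

Definition Buchsbaum_complex (k : fieldType) (n : nat)
    (Delta : {set {set 'I_n}}) : Prop :=
  pure Delta /\
  forall F, F \in Delta -> F != set0 ->
  forall i : int, i < complex_dim (link Delta F) ->
    reduced_homology k (link Delta F) i = 0%VS.

Definition Buchsbaum (k : fieldType) (n : nat) (G : sgraph n) : Prop :=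
  Buchsbaum_complex k (Ind G).

Section CommutativeAlgebra.
Variable A : comNzRingType.

(* The ideal generated by s; the coefficients c i with i >= size s are unused. *)
Definition ideal_gen (s : seq A) : {pred A} :=
  fun a => asbool (exists c : nat -> A, a = \sum_(i < size s) c i * s`_i).

Fact ideal_gen_closed (s : seq A) :
  1 \notin ideal_gen s -> idealr_closed (ideal_gen s).
Proof.
move=> s1; split=> // [|a u v /asboolP[c ->] /asboolP[c' ->]]; apply/asboolP.
  by exists (fun=> 0); rewrite big1 // => i _; rewrite mul0r.
exists (fun i => a * c i + c' i); rewrite mulr_sumr -big_split /=.
by apply: eq_bigr => i _; rewrite mulrDl mulrA.
Qed.

(* A strict chain of primes P 0, ..., P r.  Boolean predicates cover all subsets
   of A classically (via [asbool]); [idealr_closed] includes properness. *)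
Definition prime_chain (r : nat) (P : nat -> {pred A}) : Prop :=
  (forall i, (i <= r)%N -> idealr_closed (P i) /\ prime_idealr_closed (P i)) /\
  (forall i, (i < r)%N ->
     {subset P i <= P i.+1} /\ exists2 a, a \in P i.+1 & a \notin P i).

Definition krull_dim_eq (r : nat) : Prop :=
  (exists P, prime_chain r P) /\
  (forall r' P, prime_chain r' P -> (r' <= r)%N).

(* Each s`_i is a nonzerodivisor modulo the previous terms, and the quotient by
   the whole sequence is nonzero. *)
Definition regular_seq (s : seq A) : Prop :=
  (forall i, (i < size s)%N ->
     forall a, s`_i * a \in ideal_gen (take i s) -> a \in ideal_gen (take i s))
  /\ 1 \notin ideal_gen s.
End CommutativeAlgebra.

Section EdgeIdeal.
Variables (k : fieldType) (n : nat) (G : sgraph n).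

Definition edge_monomials : seq {mpoly k[n]} :=
  [seq 'X_e.1 * 'X_e.2 | e <- enum [pred e : 'I_n * 'I_n | G e.1 e.2]].

Definition edge_ideal : {pred {mpoly k[n]}} := ideal_gen edge_monomials.

Fact edge_ideal1 : 1 \notin edge_ideal.
Proof.
apply/negP => /asboolP[c].
move/(congr1 (fun p : {mpoly k[n]} => p.@[fun=> 0])).
rewrite meval1 raddf_sum /= big1 => [|i _]; first by move/eqP; rewrite oner_eq0.
have : edge_monomials`_i \in edge_monomials by rewrite mem_nth.
by case/mapP => e _ ->; rewrite !mevalM !mevalXU mul0r mulr0.
Qed.

HB.instance Definition _ :=
  isIdealr.Build {mpoly k[n]} edge_ideal (ideal_gen_closed edge_ideal1).

Definition edge_ring : comNzRingType := {ideal_quot edge_ideal}.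

Definition to_edge_ring (p : {mpoly k[n]}) : edge_ring :=
  \pi_{ideal_quot edge_ideal} p.

Definition irrelevant_ideal : {pred {mpoly k[n]}} :=
  ideal_gen [seq 'X_i | i <- enum 'I_n].

(* A regular sequence on R/I(G) consisting of elements of <x_1, ..., x_n>; an
   element of R acts on R/I(G) through its class. *)
Definition edge_regular_seq (s : seq {mpoly k[n]}) : Prop :=
  {subset s <= irrelevant_ideal} /\ regular_seq (map to_edge_ring s).

Definition edge_depth_eq (r : nat) : Prop :=
  (exists2 s, edge_regular_seq s & size s = r) /\
  (forall s, edge_regular_seq s -> (size s <= r)%N).

Definition CohenMacaulay : Prop :=
  exists r, krull_dim_eq edge_ring r /\ edge_depth_eq r.
End EdgeIdeal.

(* Main.v *)
(* Independent sets of [C_n(1..d)] have consecutive gaps at least [d+1], and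
   maximal ones have gaps at most [2d+1], so that [Ind G] is impure as soon as
   [n >= 3d+3] and [n <> 4d+3]: sets with [n %/ d.+1] elements and maximal sets with
   fewer elements coexist.  For the remaining [n] the complex is a set of points,
   a matching ([n = 2d+2]), a connected graph, or of dimension two ([n = 4d+3]).

   Cohen-Macaulayness is decided without local cohomology.  Any [r+1] elements of
   the edge ring, where [r] bounds the size of independent sets, satisfy a
   polynomial relation; a lexicographically minimal monomial of it shows that
   neither a chain of primes nor a regular sequence has length [r+1].  The
   symmetric functions [sigma1] and [sigma2] of the faces form a regular sequence
   when [Ind G] is a connected graph.  Conversely, a regular sequence in the
   irrelevant ideal kills the Koszul cohomology of the variables in low degrees,
   and its squarefree part is the simplicial cohomology of [Ind G]: for
   [n = 2d+2] the class of a component in [H^0], for [n = 4d+3] a winding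
   number in [H^1], obstructs depth 2, respectively 3. *)
Require Import Defs.
From HB Require Import structures.
From mathcomp Require Import all_boot all_order all_algebra.
From mathcomp Require Import generic_quotient ring_quotient boolp mpoly.
From mathcomp Require Import zify ring.

Set Implicit Arguments.
Unset Strict Implicit.
Unset Printing Implicit Defensive.

Import Order.TTheory GRing.Theory Num.Theory.

(** * Ideals, and cancellation along increasing chains of ideals *)

Section Ideals.
Local Open Scope ring_scope.
Variable A : comNzRingType.
Implicit Types (J : {pred A}) (s : seq A).

(** Properness is left out, in contrast to [idealr_closed], so that every [ideal_gen s]
    qualifies. *)
Definition ideal_closed J := 0 \in J /\ forall a u v, u \in J -> v \in J -> a * u + v \in J.

Section Closed.
Variables (J : {pred A}) (clJ : ideal_closed J).

Lemma ideal0 : 0 \in J. Proof. by case: clJ. Qed.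

Lemma idealD u v : u \in J -> v \in J -> u + v \in J.
Proof. by move=> uJ vJ; rewrite -[u]mul1r; case: clJ => _; apply. Qed.

Lemma ideal_mull a u : u \in J -> a * u \in J.
Proof. by move=> uJ; rewrite -[_ * _]addr0; case: clJ => J0; apply. Qed.

Lemma ideal_mulr a u : u \in J -> u * a \in J.
Proof. by rewrite mulrC; apply: ideal_mull. Qed.

Lemma idealN u : u \in J -> - u \in J.
Proof. by move=> uJ; rewrite -mulN1r ideal_mull. Qed.

Lemma idealB u v : u \in J -> v \in J -> u - v \in J.
Proof. by move=> uJ vJ; rewrite idealD ?idealN. Qed.

Lemma ideal_sum (I : Type) (r : seq I) (P : pred I) (F : I -> A) :
  (forall i, P i -> F i \in J) -> \sum_(i <- r | P i) F i \in J.
Proof. by move=> FJ; elim/big_ind: _ => //; [exact: ideal0 | exact: idealD]. Qed.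
End Closed.

Lemma idealr_closedW J : idealr_closed J -> ideal_closed J.
Proof. by case. Qed.

Lemma ideal_gen_ideal s : ideal_closed (ideal_gen s).
Proof.
split=> [|a u v /asboolP[c ->] /asboolP[c' ->]]; apply/asboolP.
  by exists (fun=> 0); rewrite big1 // => i _; rewrite mul0r.
exists (fun i => a * c i + c' i); rewrite mulr_sumr -big_split /=.
by apply: eq_bigr => i _; rewrite mulrDl mulrA.
Qed.

Lemma mem_ideal_gen s a : a \in s -> a \in ideal_gen s.
Proof.
move=> sa; apply/asboolP; exists (fun i => (i == index a s)%:R).
have ltas : (index a s < size s)%N by rewrite index_mem.
rewrite (bigD1 (Ordinal ltas)) //= eqxx mul1r nth_index // big1 ?addr0 // => i.
by rewrite -val_eqE => /negPf /= ->; rewrite mul0r.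
Qed.

Lemma ideal_gen_sub s J : ideal_closed J -> {subset s <= J} -> {subset ideal_gen s <= J}.
Proof.
move=> clJ sJ _ /asboolP[c ->]; apply: ideal_sum => // i _.
by apply/ideal_mull/sJ/mem_nth.
Qed.

Lemma ideal_gen_takeS s i : {subset ideal_gen (take i s) <= ideal_gen (take i.+1 s)}.
Proof.
apply: ideal_gen_sub => [|a]; first exact: ideal_gen_ideal.
move=> sa; apply: mem_ideal_gen; move: sa.
by rewrite -(take_takel s (leqnSn i)); apply: mem_take.
Qed.

Lemma ideal_gen_nil : ideal_gen [::] =i pred1 (0 : A).
Proof.
move=> a; apply/idP/eqP => [/asboolP[c ->]|->]; first by rewrite big_ord0.
by have [] := ideal_gen_ideal [::].
Qed.

Lemma ideal_gen_takeSE s i a : (i < size s)%N -> a \in ideal_gen (take i.+1 s) ->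
  exists b, a - b * s`_i \in ideal_gen (take i s).
Proof.
move=> lti; rewrite (take_nth 0) // => /asboolP[c].
rewrite size_rcons big_ord_recr /= nth_rcons ltnn eqxx => ->.
exists (c (size (take i s))); rewrite addrK; apply: ideal_sum => [|j _].
  exact: ideal_gen_ideal.
apply: ideal_mull; first exact: ideal_gen_ideal.
by rewrite nth_rcons ltn_ord; apply/mem_ideal_gen/mem_nth.
Qed.

(* At stage [j] the terms that are lexicographically minimal in the first [j]
   exponents are kept, and their common power of [a j] is cancelled. *)
Lemma chain_no_relation (r N : nat) (J : nat -> {pred A}) (a : 'I_r -> A)
    (c : {ffun 'I_r -> 'I_N} -> A) :
    (forall j, (j <= r)%N -> ideal_closed (J j)) ->
    (forall j : 'I_r, {subset J j <= J j.+1}) ->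
    (forall j : 'I_r, a j \in J j.+1) ->
    (forall (j : 'I_r) b, a j * b \in J j -> b \in J j) ->
    (forall e, c e != 0 -> c e \notin J r) ->
    \sum_e c e * \prod_i a i ^+ e i \in J 0%N ->
  forall e, c e = 0.
Proof.
move=> clJ subJ aJ regJ cJ rel e0; apply/eqP/negP => /negP ce0.
have stage j : (j <= r)%N -> exists S : {set {ffun 'I_r -> 'I_N}},
   [/\ S != set0, {in S, forall e, c e != 0},
       {in S &, forall (e e' : {ffun 'I_r -> 'I_N}) (i : 'I_r), (i < j)%N -> e i = e' i} &
       \sum_(e in S) c e * \prod_(i : 'I_r | (j <= i)%N) a i ^+ e i \in J j].
  elim: j => [_ | j IHj ltj].
    exists [set e | c e != 0]; split=> [|e|//|].
    - by apply/set0Pn; exists e0; rewrite inE.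
    - by rewrite inE.
    rewrite (bigID [pred e | c e != 0]) /= [X in _ + X]big1 in rel; last first.
      by move=> e /negPn/eqP->; rewrite mul0r.
    by rewrite addr0 in rel; rewrite (eq_bigl (fun e => c e != 0)) => [|e]; rewrite ?inE.
  have [S [S0 cS eqS relS]] := IHj (ltnW ltj); pose j' := Ordinal ltj.
  have clJj := clJ j (ltnW ltj); have clJj1 := clJ j.+1 ltj.
  have /set0Pn[e1 Se1] := S0.
  pose em := [arg min_(e < e1 in S) (e j' : nat)].
  have [Sem minm] : em \in S /\ {in S, forall e : {ffun 'I_r -> 'I_N}, (em j' <= e j')%N}.
    by rewrite /em; case: arg_minnP => [//|e Se min_e]; split=> // e' /min_e.
  have regX m b : a j' ^+ m * b \in J j -> b \in J j.
    by elim: m => [|m IHm]; [rewrite mul1r | rewrite exprS -mulrA => /regJ/IHm].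
  pose G (e : {ffun 'I_r -> 'I_N}) :=
    c e * \prod_(i : 'I_r | (j.+1 <= i)%N) a i ^+ e i.
  have prodE (e : {ffun 'I_r -> 'I_N}) : e \in S ->
      c e * \prod_(i : 'I_r | (j <= i)%N) a i ^+ e i
      = a j' ^+ em j' * (a j' ^+ (e j' - em j') * G e).
    move=> Se; rewrite (bigD1 j') //= [RHS]mulrA -exprD subnKC ?minm // /G mulrCA.
    congr (_ * (_ * _)); apply: eq_bigl => i.
    by rewrite -val_eqE /= ltn_neqAle eq_sym andbC.
  rewrite (eq_bigr _ prodE) -mulr_sumr in relS.
  have {}relS : \sum_(e in S) a j' ^+ (e j' - em j') * G e \in J j.
    exact: regX relS.
  exists [set e in S | e j' == em j']; split.
  - by apply/set0Pn; exists em; rewrite inE Sem eqxx.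
  - by move=> e; rewrite inE => /andP[/cS].
  - move=> e e'; rewrite !inE => /andP[Se /eqP ej] /andP[Se' /eqP ej'] i.
    rewrite ltnS leq_eqVlt => /orP[/eqP ij|]; last exact: eqS.
    by rewrite (_ : i = j') ?ej //; apply: val_inj.
  move/(subJ j'): relS; rewrite (bigID (fun e : {ffun 'I_r -> 'I_N} => e j' == em j')) /= => relS.
  (* A term whose exponent at [j] exceeds the minimum keeps a factor [a j], which lies in
     [J j.+1]. *)
  have tailJ : \sum_(e in S | e j' != em j') a j' ^+ (e j' - em j') * G e \in J j.+1.
    apply: ideal_sum => // e /andP[Se nej]; apply: ideal_mulr => //.
    have: (0 < e j' - em j')%N by rewrite subn_gt0 ltn_neqAle eq_sym nej minm.
    by case: (_ - _)%N => // m _; rewrite exprS; apply: ideal_mulr => //; apply: (aJ j').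
  have := idealB clJj1 relS tailJ; rewrite addrK.
  rewrite (eq_bigl (fun e => e \in [set e in S | e j' == em j'])) => [|e]; last by rewrite inE.
  rewrite (eq_bigr G) // => e; rewrite inE => /andP[_ /eqP->].
  by rewrite subnn mul1r.
(* At stage [r] the exponents in [S] agree everywhere, so a single coefficient [c e] is left in
   [J r]. *)
have [S [/set0Pn[e Se] cS eqS]] := stage r (leqnn r).
rewrite (big_setD1 e) //= big_pred0 => [|i]; last by rewrite leqNgt ltn_ord.
rewrite big1 => [|e']; last first.
  rewrite !inE => /andP[/eqP ne_e'e Se']; case: ne_e'e.
  by apply/ffunP => i; apply: eqS.
by rewrite mulr1 addr0; apply/negP/cJ/cS.
Qed.
End Ideals.

#[local] Hint Resolve ideal_gen_ideal : core.

(* Acyclicity of the Koszul cochain complex of [x] below the length of a regular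
   sequence inside the ideal of [x], in degrees 0, 1 and 2.  Contraction with
   [c], where [f = \sum_i c i * x i], is a homotopy between multiplication by [f]
   and zero. *)
Section KoszulAcyclicity.
Local Open Scope ring_scope.
Variables (A : comNzRingType) (n : nat) (x : 'I_n -> A) (s : seq A).
Hypothesis reg_s : regular_seq s.
Hypothesis s_x : forall f, f \in s -> exists c : 'I_n -> A, f = \sum_i c i * x i.

Let J i := ideal_gen (take i s).
Let clJ i : ideal_closed (J i). Proof. exact: ideal_gen_ideal. Qed.

Lemma koszul_acyclic0 i w : (i < size s)%N -> (forall j, x j * w \in J i) -> w \in J i.
Proof.
move=> lti xw; apply: reg_s.1 => //; have [c ->] := s_x (mem_nth 0 lti).
rewrite mulr_suml; apply: (ideal_sum (clJ i)) => // j _.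
by rewrite -mulrA; apply: (ideal_mull (clJ i)).
Qed.

Lemma koszul_acyclic1 i (w : 'I_n -> A) : (i.+1 < size s)%N ->
    (forall j l, x j * w l - x l * w j \in J i) ->
  exists z, forall l, w l - x l * z \in J i.
Proof.
move=> lti cocycle; have lti' := ltnW lti.
have [c fE] := s_x (mem_nth 0 lti').
pose e := \sum_j c j * w j.
have fw l : s`_i * w l - x l * e \in J i.
  rewrite fE mulr_suml mulr_sumr -sumrB; apply: (ideal_sum (clJ i)) => // j _.
  by rewrite (_ : _ - _ = c j * (x j * w l - x l * w j)); [apply: (ideal_mull (clJ i)) | ring].
(* Modulo [J i] the product [x l * e] equals [w l] times the next term of [s], so it lies in
   [J i.+1] and degree 0 applies. Then [e] is a multiple of that term modulo [J i], and the term
   cancels. *)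
have : e \in J i.+1.
  apply: koszul_acyclic0 => // l.
  rewrite (_ : x l * e = s`_i * w l - (s`_i * w l - x l * e)); last by ring.
  apply: (idealB (clJ i.+1)) => //; last exact: ideal_gen_takeS.
  by apply: (ideal_mulr (clJ i.+1)) => //; rewrite /J (take_nth 0) // mem_ideal_gen // mem_rcons mem_head.
move=> /(ideal_gen_takeSE lti')[z ez]; exists z => l; apply: reg_s.1 => //.
rewrite (_ : _ * _ = s`_i * w l - x l * e + x l * (e - z * s`_i)); last by ring.
by apply: (idealD (clJ i)) => //; apply: (ideal_mull (clJ i)).
Qed.

Lemma koszul_acyclic2 i (w : 'I_n -> 'I_n -> A) : (i.+2 < size s)%N ->
    (forall h j l, x h * w j l - x j * w h l + x l * w h j \in J i) ->
  exists z : 'I_n -> A, forall j l, w j l - (x j * z l - x l * z j) \in J i.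
Proof.
move=> lti cocycle; have lti' := ltnW (ltnW lti).
have [c fE] := s_x (mem_nth 0 lti').
pose e l := \sum_h c h * w h l.
have fw j l : s`_i * w j l - (x j * e l - x l * e j) \in J i.
  rewrite fE mulr_suml !mulr_sumr -!sumrB; apply: (ideal_sum (clJ i)) => // h _.
  rewrite (_ : _ - _ = c h * (x h * w j l - x j * w h l + x l * w h j)); last by ring.
  exact: (ideal_mull (clJ i)).
(* Modulo [J i.+1] the contraction [e] is a 1-cocycle. *)
have [|z ez] := @koszul_acyclic1 i.+1 e lti.
  move=> j l.
  rewrite (_ : _ - _ = s`_i * w j l - (s`_i * w j l - (x j * e l - x l * e j))); last by ring.
  apply: (idealB (clJ i.+1)) => //; last exact: ideal_gen_takeS.
  by apply: (ideal_mulr (clJ i.+1)) => //; rewrite /J (take_nth 0) // mem_ideal_gen // mem_rcons mem_head.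
have /choice[y ey] l : exists y, e l - x l * z - y * s`_i \in J i.
  exact: ideal_gen_takeSE.
exists y => j l; apply: reg_s.1 => //.
rewrite (_ : _ * _ = s`_i * w j l - (x j * e l - x l * e j)
   + (x j * (e l - x l * z - y l * s`_i) - x l * (e j - x j * z - y j * s`_i))); last by ring.
by apply: (idealD (clJ i)) => //; apply: (idealB (clJ i)) => //; apply: (ideal_mull (clJ i)).
Qed.
End KoszulAcyclicity.

(** * The edge ring and its monomial basis *)

Definition msupport n (m : 'X_{1..n}) : {set 'I_n} := [set i | m i != 0%N].

Section EdgeRing.
Local Open Scope ring_scope.
Local Open Scope quotient_scope.
Variables (k : fieldType) (n : nat) (G : sgraph n).
Local Notation pi := (@to_edge_ring k n G).
Local Notation I := (@edge_ideal k n G).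

Fact to_edge_ring_is_additive : zmod_morphism pi.
Proof. by move=> p q; rewrite /to_edge_ring raddfB. Qed.

Fact to_edge_ring_is_multiplicative : monoid_morphism pi.
Proof. by split=> [|p q]; rewrite /to_edge_ring ?rmorph1 // rmorphM. Qed.

HB.instance Definition _ := GRing.isZmodMorphism.Build _ _ pi to_edge_ring_is_additive.
HB.instance Definition _ :=
  GRing.isMonoidMorphism.Build _ _ pi to_edge_ring_is_multiplicative.

Lemma to_edge_ring_eq0 p : (pi p == 0) = (p \in I).
Proof.
rewrite -[p in RHS]subr0 Quotient.idealrBE /to_edge_ring.
by rewrite (_ : 0 = \pi_{ideal_quot I} 0) // raddf0.
Qed.

Lemma to_edge_ring_eq p q : (pi p == pi q) = (p - q \in I).
Proof. by rewrite -to_edge_ring_eq0 raddfB subr_eq0. Qed.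

Lemma to_edge_ring_surj (a : edge_ring k G) : exists p, a = pi p.
Proof. by exists (repr a); rewrite /to_edge_ring reprK. Qed.

Lemma Ind_sub (S T : {set 'I_n}) : S \in Ind G -> T \subset S -> T \in Ind G.
Proof. by have [_] := Ind_complex G; apply. Qed.

Lemma msupportD (m m' : 'X_{1..n}) : msupport (m + m') = msupport m :|: msupport m'.
Proof. by apply/setP => i; rewrite !inE mnmDE addn_eq0 negb_and. Qed.

Lemma msupport0 : msupport (0%MM : 'X_{1..n}) = set0.
Proof. by apply/setP => i; rewrite !inE mnm0E. Qed.

Lemma msupport1 i : msupport (U_(i)%MM : 'X_{1..n}) = [set i].
Proof. by apply/setP => j; rewrite !inE mnm1E [j == i]eq_sym; case: (i == j). Qed.

(** The edge ideal is a monomial ideal: a monomial whose support is not independent is divisible by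
    some edge monomial, while divisors of a monomial with independent support again have independent
    support. *)
Lemma edge_idealP p :
  reflect (forall m, msupport m \in Ind G -> p@_m = 0) (p \in I).
Proof.
have clI := ideal_gen_ideal (edge_monomials k G).
apply: (iffP idP) => [|p0].
  move=> + m mG; move: p m mG.
  suff IJ : {subset I <= [pred p : {mpoly k[n]} | `[< forall m, msupport m \in Ind G -> p@_m = 0 >]]}.
    by move=> q m mG /IJ; rewrite inE => /asboolP/(_ m mG).
  apply: ideal_gen_sub => [|_ /mapP[[i j] /= + ->]].
    split=> [|a u v]; rewrite !inE.
      by apply/asboolP => m _; rewrite mcoeff0.
    move=> /asboolP u0 /asboolP v0; apply/asboolP => m mG.
    rewrite mcoeffD v0 // addr0 mcoeffM big1 // => h /eqP mE.
    have sub_m : msupport h.2 \subset msupport (h.1 + h.2)%MM by rewrite msupportD subsetUr.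
    by rewrite -mE in sub_m; rewrite u0 ?mulr0 // (Ind_sub mG).
  rewrite mem_enum inE => Gij; apply/asboolP => m mG.
  rewrite -mpolyXD mcoeffX; case: eqP => // mE; move: mG.
  rewrite -mE msupportD !msupport1 inE => /forall_inP/(_ i).
  by rewrite !inE eqxx => /(_ isT)/forall_inP/(_ j); rewrite !inE eqxx orbT Gij => /(_ isT).
rewrite [p]mpolyE big_seq; apply: ideal_sum => // m; rewrite mcoeff_msupp => pm.
have : msupport m \notin Ind G by apply: contra pm => /p0 ->.
rewrite inE negb_forall => /existsP[i]; rewrite negb_imply => /andP[mi].
rewrite negb_forall => /existsP[j]; rewrite negb_imply negbK => /andP[mj Gij].
have ne_ij : i != j by apply: contraTneq Gij => ->; rewrite edge_irr.
have le_m : (U_(i) + U_(j) <= m)%MM.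
  apply/mnm_lepP => l; move: mi mj; rewrite !inE mnmDE !mnm1E.
  have [<-{l}|_] := eqVneq i l; last by have [<-|_] := eqVneq j l; lia.
  by rewrite [j == i]eq_sym (negPf ne_ij); lia.
rewrite -(submK le_m) mpolyXD -mul_mpolyC mulrA; apply: ideal_mull => //.
apply/mem_ideal_gen/mapP; exists (i, j); first by rewrite mem_enum inE.
by rewrite mpolyXD.
Qed.
End EdgeRing.

(** * Algebraic dependence in the edge ring, bounding prime chains and regular sequences *)

Lemma nontrivial_linear_relation (k : fieldType) (T U : finType) (M : T -> U -> k) :
  (#|U| < #|T|)%N ->
  exists2 c : T -> k, exists t, c t != 0%R & forall u, (\sum_t c t * M t u = 0)%R.
Proof.
move=> ltUT; pose B := (\matrix_(i < #|T|, j < #|U|) M (enum_val i) (enum_val j))%R.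
have : (kermx B != 0)%R.
  by rewrite -mxrank_eq0 mxrank_ker subn_eq0 -ltnNge (leq_ltn_trans (rank_leq_col B)).
case/rowV0Pn => v /sub_kermxP vB /rV0Pn[i vi].
exists (fun t => v 0%R (enum_rank t)) => [|u]; first by exists (enum_val i); rewrite enum_valK.
have := congr1 (fun w : 'rV_#|U| => w 0%R (enum_rank u)) vB; rewrite !mxE => vBu.
rewrite (big_enum_val (A := {: T})) /= -[RHS]vBu.
by apply: eq_bigr => j _; rewrite mxE enum_rankK enum_valK.
Qed.

Section AlgebraicDependence.
Local Open Scope ring_scope.
Variables (k : fieldType) (n : nat).
Implicit Types (p q : {mpoly k[n]}).

(** Since [msize] is the degree plus one, and 0 at the zero polynomial, [msize p <= d.+1] means
    degree at most [d], zero included. *)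
Lemma msizeM_leS p q d e : (msize p <= d.+1 -> msize q <= e.+1 -> msize (p * q) <= (d + e).+1)%N.
Proof.
have [->|p0] := eqVneq p 0; first by rewrite mul0r msize0.
have [->|q0] := eqVneq q 0; first by rewrite mulr0 msize0.
by move=> pd qe; rewrite msizeM //; move: pd qe; case: (msize p) (msize q) => [|x] [|y] /=; lia.
Qed.

Lemma msizeX_leS p d m : (msize p <= d.+1 -> msize (p ^+ m) <= (d * m).+1)%N.
Proof.
move=> pd; elim: m => [|m IHm]; first by rewrite expr0 msize1.
by rewrite exprS mulnS; apply: msizeM_leS.
Qed.

Lemma msize_prodX_leS r (a : 'I_r -> {mpoly k[n]}) (e : 'I_r -> nat) d :
  (forall i, (msize (a i) <= d.+1)%N) ->
  (msize (\prod_i a i ^+ e i) <= (\sum_i d * e i)%N.+1)%N.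
Proof.
move=> ad; elim/big_ind2: _ => [|p s q t ps qt|i _]; first by rewrite msize1.
  exact: msizeM_leS.
exact: msizeX_leS.
Qed.

Lemma mcoeff_msize_le p (m : 'X_{1..n}) : (msize p <= mdeg m)%N -> p@_m = 0.
Proof. by move=> ?; apply/memN_msupp_eq0/msize_mdeg_ge. Qed.

(** Decodes a monomial from its support and the exponents listed along [enum] of it. Positions from
    [r] on get exponent 0, so the codes form a finite type that is easy to count. *)
Definition spread r b (Fh : {set 'I_n} * {ffun 'I_r -> 'I_b}) : 'X_{1..n} :=
  [multinom if v \in Fh.1 then oapp (fun i => Fh.2 i : nat) 0%N (insub (index v (enum Fh.1)))
            else 0%N | v < n].

Lemma spread_msupport r b (m : 'X_{1..n}) :
    (#|msupport m| <= r)%N -> (forall v, m v < b.+1)%N ->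
  exists Fh, m = spread (r := r) (b := b.+1) Fh.
Proof.
move=> mr mb; set F := msupport m.
exists (F, [ffun i : 'I_r => inord (nth 0%N [seq m v | v <- enum F] i)]).
apply/mnmP => v; rewrite mnmE /=; case: ifPn => [Fv|]; last by rewrite inE negbK => /eqP.
have lt_v : (index v (enum F) < size (enum F))%N by rewrite index_mem mem_enum.
have lt_r : (index v (enum F) < r)%N by rewrite (leq_trans lt_v) // -cardE.
rewrite insubT /= ffunE /= (nth_map v) // nth_index ?mem_enum //.
by rewrite inordK.
Qed.

(* Modulo the edge ideal only monomials with independent support survive; at most
   [2 ^ n * b.+1 ^ r] of them have exponents at most [b], which is linear in [N],
   against the [N ^ r.+1] monomials in the [a i] with exponents below [N]. *)
Lemma algebraic_dependence (G : sgraph n) r (a : 'I_r.+1 -> {mpoly k[n]}) :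
    (forall F, F \in Ind G -> (#|F| <= r)%N) ->
  exists N (c : {ffun 'I_r.+1 -> 'I_N} -> k), (exists e, c e != 0) /\
    \sum_e (c e)%:MP * \prod_i a i ^+ e i \in @edge_ideal k n G.
Proof.
move=> Gr; pose D := \max_i msize (a i).
have aD i : (msize (a i) <= D.+1)%N by apply/leqW/(@leq_bigmax _ (fun i => msize (a i))).
(* Here [b] bounds the degree of every [P e]. Since [b.+1 <= C * N] and [2 ^ n * C ^ r < N], there
   are at most [2 ^ n * (C * N) ^ r < N ^ r.+1] codes. *)
pose C := (r.+1 * D).+1; pose N := (2 ^ n * C ^ r).+1; pose b := (r.+1 * D * N)%N.
pose T := {ffun 'I_r.+1 -> 'I_N}; pose U := ({set 'I_n} * {ffun 'I_r -> 'I_b.+1})%type.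
pose P (e : T) := \prod_i a i ^+ e i.
have szP e : (msize (P e) <= b.+1)%N.
  apply: leq_trans (msize_prodX_leS _ aD) _; rewrite ltnS.
  apply: (@leq_trans (\sum_(i < r.+1) D * N)).
    by apply: leq_sum => i _; rewrite leq_mul2l (ltnW (ltn_ord _)) orbT.
  by rewrite sum_nat_const card_ord mulnA.
have ltUT : (#|{: U}| < #|{: T}|)%N.
  rewrite card_prod !card_ffun !card_ord -cardsT -powersetT card_powerset cardsT card_ord.
  have le_b : (b.+1 <= C * N)%N by rewrite /b mulSn /N; lia.
  apply: leq_ltn_trans (_ : 2 ^ n * (C ^ r * N ^ r) < _)%N.
    by rewrite -expnMn leq_mul //; case: (posnP r) => [->|r_gt0]; rewrite ?expn0 ?leq_exp2r.
  by rewrite mulnA expnS ltn_pmul2r ?expn_gt0.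
have [c c0 cM] := nontrivial_linear_relation (fun e (Fh : U) => (P e)@_(spread Fh)) ltUT.
exists N, c; split=> //; apply/edge_idealP => m mG.
rewrite raddf_sum /=; under eq_bigr => e _ do rewrite mcoeffCM -/(P e).
have [le_m | lt_m] := leqP b.+1 (mdeg m).
  by rewrite big1 // => e _; rewrite mcoeff_msize_le ?mulr0 // (leq_trans (szP e)).
have [|v|Fh ->] := @spread_msupport r b m; [exact: Gr | | exact: cM].
by apply: leq_ltn_trans lt_m; rewrite mdegE (bigD1 v) //= leq_addr.
Qed.

Variable G : sgraph n.

(* Applied both to chains of primes and to the ideals generated by the initial
   segments of a regular sequence. *)
Lemma edge_ring_chain_length r (J : nat -> {pred edge_ring k G}) (a : 'I_r -> edge_ring k G) :
    (forall j, (j <= r)%N -> ideal_closed (J j)) ->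
    (forall j : 'I_r, {subset J j <= J j.+1}) ->
    (forall j : 'I_r, a j \in J j.+1) ->
    (forall (j : 'I_r) b, a j * b \in J j -> b \in J j) ->
    1 \notin J r ->
  exists2 F, F \in Ind G & (r <= #|F|)%N.
Proof.
case: r a => [|r] a clJ subJ aJ regJ J1.
  by exists set0 => //; have [] := Ind_complex G.
have [/exists_inP//|] := boolP [exists F in Ind G, (r < #|F|)%N].
rewrite negb_exists_in => /forall_inP small.
have /fin_all_exists[p pE] i := to_edge_ring_surj (a i).
have [|N [c [[e0 ce0] cI]]] := @algebraic_dependence G r p.
  by move=> F /small; rewrite -leqNgt.
(* A nonzero constant survives in the edge ring, because the support [set0] of the monomial 1 is
   independent. *)
suff /(_ e0)/eqP : forall e, to_edge_ring G (c e)%:MP = 0.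
  rewrite to_edge_ring_eq0 => /edge_idealP/(_ 0%MM).
  rewrite msupport0 mcoeffC eqxx mulr1 => c0.
  by case/eqP: ce0; apply: c0; have [] := Ind_complex G.
apply: (chain_no_relation clJ subJ aJ regJ) => [e ce|].
  apply: contra J1 => cJ.
  have -> : 1 = to_edge_ring G (c e)^-1%:MP * to_edge_ring G (c e)%:MP.
    rewrite -rmorphM -mpolyCM mulVf ?mpolyC1 ?rmorph1 //.
    by apply: contraNneq ce => ->; rewrite mpolyC0 raddf0.
  exact: ideal_mull (clJ _ _) _ _ cJ.
move: cI; rewrite -to_edge_ring_eq0 raddf_sum => /eqP cI.
rewrite -[X in X \in _](_ : 0 = _); first by have [] := clJ 0%N isT.
rewrite -[LHS]cI; apply: eq_bigr => e _.
rewrite /= rmorphM rmorph_prod; congr (_ * _); apply: eq_bigr => i _.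
by rewrite rmorphXn pE.
Qed.

(** Primality makes any element of [P i.+1] outside [P i] cancellable modulo [P i]. *)
Lemma edge_ring_prime_chain_le r (P : nat -> {pred edge_ring k G}) :
  prime_chain r P -> exists2 F, F \in Ind G & (r <= #|F|)%N.
Proof.
case=> primeP strictP.
have /fin_all_exists[a aP] (i : 'I_r) : exists a, a \in P i.+1 /\ a \notin P i.
  by have [_ [a]] := strictP i (ltn_ord i); exists a.
apply: (@edge_ring_chain_length r P a) => [j lej|j|j|j b|].
- by have [/idealr_closedW] := primeP j lej.
- by have [] := strictP j (ltn_ord j).
- by have [] := aP j.
- have [_ prPj] := primeP j (ltnW (ltn_ord j)); have [_ naj] := aP j.
  by move/prPj; rewrite (negPf naj).
by have [[]] := primeP r (leqnn r).
Qed.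

Lemma edge_regular_seq_size_le (s : seq {mpoly k[n]}) :
  edge_regular_seq G s -> exists2 F, F \in Ind G & (size s <= #|F|)%N.
Proof.
case=> _; set t := map _ s => -[reg_t t1]; have sz_t : size t = size s by apply: size_map.
rewrite -sz_t.
apply: (@edge_ring_chain_length _ (fun j => ideal_gen (take j t)) (fun j => t`_j)) => [j _|j|j|j b|].
- exact: ideal_gen_ideal.
- exact: ideal_gen_takeS.
- by apply: mem_ideal_gen; rewrite (take_nth 0) // mem_rcons mem_head.
- exact: reg_t.
by rewrite take_size.
Qed.
End AlgebraicDependence.

(** * Restriction of polynomials to a set of variables *)

Section Restriction.
Local Open Scope ring_scope.
Variables (k : fieldType) (n : nat).
Implicit Types (p q : {mpoly k[n]}) (F : {set 'I_n}).

(* The substitution [x_i := 0] for all [i \notin F]. *)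
Definition restr F : {mpoly k[n]} -> {mpoly k[n]} :=
  mmap (@mpolyC n k) (fun i => if i \in F then 'X_i else 0).

HB.instance Definition _ F := GRing.RMorphism.on (restr F).

Lemma restrX F (m : 'X_{1..n}) : restr F 'X_[m] = if msupport m \subset F then 'X_[m] else 0.
Proof.
rewrite /restr mmapX /mmap1; case: ifPn => [/subsetP mF | /subsetPn[i]].
  rewrite [RHS]mpolyXE_id; apply: eq_bigr => i _; have [//|iF] := boolP (i \in F).
  have : i \notin msupport m by apply: contra iF => /mF.
  by rewrite inE negbK => /eqP->; rewrite !expr0.
by rewrite inE => mi /negPf iF; rewrite (bigD1 i) //= iF expr0n (negPf mi) mul0r.
Qed.

Lemma restrXi F i : restr F 'X_i = if i \in F then 'X_i else 0.
Proof. by rewrite restrX msupport1 sub1set. Qed.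

Lemma mcoeff_restr F p m : (restr F p)@_m = if msupport m \subset F then p@_m else 0.
Proof.
rewrite {1}[p]mpolyE [restr F _]raddf_sum raddf_sum /=.
under eq_bigr => l _ do rewrite -mul_mpolyC rmorphM /= /restr mmapC -/(restr F _) restrX mcoeffCM.
case: ifPn => [mF | mF]; last first.
  rewrite big1 // => l _; case: ifPn => [lF|_]; last by rewrite mcoeff0 mulr0.
  by rewrite mcoeffX; case: eqP lF mF => [->->|]; rewrite ?mulr0.
rewrite [in RHS](mpolyE p) raddf_sum /=; apply: eq_bigr => l _.
rewrite mcoeffZ; case: ifPn => // lF; rewrite mcoeff0 mcoeffX.
by case: eqP mF lF => // ->->.
Qed.

Lemma restr_eq0_sub F F' p : F \subset F' -> restr F' p = 0 -> restr F p = 0.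
Proof.
move=> FF' p0; apply/mpolyP => m; rewrite mcoeff_restr mcoeff0; case: ifP => // mF.
have := congr1 (mcoeff m) p0.
by rewrite mcoeff_restr (subset_trans mF FF') mcoeff0.
Qed.
End Restriction.

(** * Coordinate primes and the Krull dimension *)

Section PrimeChain.
Local Open Scope ring_scope.
Variables (k : fieldType) (n : nat) (G : sgraph n).

Lemma restr_edge_ideal F (p : {mpoly k[n]}) : F \in Ind G -> p \in edge_ideal G -> restr F p = 0.
Proof.
move=> FG /edge_idealP p0; apply/mpolyP => m; rewrite mcoeff_restr mcoeff0.
by case: ifP => // mF; apply: p0; apply: Ind_sub mF.
Qed.

(** For independent [F] this is the prime generated by the variables outside [F]; the choice of
    representative is then immaterial, by [coordinate_primeE]. *)
Definition coordinate_prime (F : {set 'I_n}) : {pred edge_ring k G} :=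
  fun a => restr F (repr a) == 0.

Lemma coordinate_primeE F (p : {mpoly k[n]}) : F \in Ind G ->
  (to_edge_ring G p \in coordinate_prime F) = (restr F p == 0).
Proof.
move=> FG; set q := repr (to_edge_ring G p).
have : q - p \in edge_ideal G by rewrite -to_edge_ring_eq /to_edge_ring reprK.
move/(restr_edge_ideal FG); rewrite raddfB => /eqP; rewrite subr_eq0 => /eqP<-.
by [].
Qed.

Lemma coordinate_prime_prime F : F \in Ind G ->
  idealr_closed (coordinate_prime F) /\ prime_idealr_closed (coordinate_prime F).
Proof.
move=> FG; split=> [|a b].
  split=> [||a b c].
  - by rewrite -[0](raddf0 (to_edge_ring G)) coordinate_primeE // raddf0.
  - by rewrite -[1](rmorph1 (to_edge_ring G)) coordinate_primeE // rmorph1 oner_eq0.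
  have [[p ->] [q ->]] := (to_edge_ring_surj a, to_edge_ring_surj b).
  have [t ->] := to_edge_ring_surj c.
  rewrite -rmorphM -raddfD !coordinate_primeE // => /eqP q0 /eqP t0.
  by rewrite raddfD /= rmorphM /= q0 t0 mulr0 addr0.
have [[p ->] [q ->]] := (to_edge_ring_surj a, to_edge_ring_surj b).
by rewrite -rmorphM !coordinate_primeE // rmorphM mulf_eq0.
Qed.

(** Deleting the vertices of [F] one at a time, in the order of [enum F], enlarges the coordinate
    prime; the variable of the deleted vertex witnesses strictness. *)
Lemma edge_ring_prime_chain F : F \in Ind G ->
  exists P : nat -> {pred edge_ring k G}, prime_chain #|F| P.
Proof.
move=> FG; pose Fi i := [set v in F | (i <= index v (enum F))%N].
have FiG i : Fi i \in Ind G by apply: Ind_sub FG _; apply/subsetP => v; rewrite inE => /andP[].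
exists (fun i => coordinate_prime (Fi i)); split=> i lei; first exact: coordinate_prime_prime.
rewrite cardE in lei; split=> [a|].
  have [p ->] := to_edge_ring_surj a; rewrite !coordinate_primeE // => /eqP p0.
  apply/eqP; apply: restr_eq0_sub p0; apply/subsetP => v.
  by rewrite !inE => /andP[-> /ltnW].
have [v Fv iv] : exists2 v, v \in F & index v (enum F) = i.
  move: (lei); case E: (enum F) => [//|v0 s] _.
  exists (nth v0 (enum F) i); first by rewrite -mem_enum mem_nth.
  by rewrite -E index_uniq ?enum_uniq.
exists (to_edge_ring G 'X_v); rewrite coordinate_primeE // restrXi inE Fv iv.
  by rewrite ltnn.
rewrite leqnn /=; apply/eqP => /(congr1 (mcoeff U_(v))).
by rewrite mcoeffXU eqxx mcoeff0 => /eqP; rewrite oner_eq0.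
Qed.

Lemma edge_ring_krull_dim r F : F \in Ind G -> #|F| = r ->
  (forall H, H \in Ind G -> (#|H| <= r)%N) -> krull_dim_eq (edge_ring k G) r.
Proof.
move=> FG Fr maxr; split; first by rewrite -Fr; apply: edge_ring_prime_chain.
by move=> s P /edge_ring_prime_chain_le[H /maxr Hr /leq_trans]; apply.
Qed.

Lemma CohenMacaulay_regular_seq r F (s : seq {mpoly k[n]}) :
    F \in Ind G -> #|F| = r -> (forall H, H \in Ind G -> (#|H| <= r)%N) ->
    edge_regular_seq G s -> size s = r -> CohenMacaulay k G.
Proof.
move=> FG Fr maxr reg_s sz_s; exists r; split; first exact: edge_ring_krull_dim FG Fr maxr.
split; first by exists s.
by move=> t /edge_regular_seq_size_le[H /maxr Hr /leq_trans]; apply.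
Qed.

Lemma CohenMacaulay_depth F : CohenMacaulay k G -> F \in Ind G ->
  exists2 s : seq {mpoly k[n]}, edge_regular_seq G s & (#|F| <= size s)%N.
Proof.
case=> r [[_ maxr] [[s reg_s sz_s] _]] FG; exists s => //.
by have [P /maxr] := edge_ring_prime_chain FG; rewrite sz_s.
Qed.
End PrimeChain.

(** * Regularity of [sigma1] and [sigma2] *)

Section RegularElements.
Local Open Scope ring_scope.
Variables (k : fieldType) (n : nat) (G : sgraph n).
Implicit Types (p q a b : {mpoly k[n]}).

(** Adjacency in the complement graph, which is the 1-skeleton of [Ind G]. *)
Definition nonadjacent : rel 'I_n := fun u v => (u != v) && ~~ G u v.

Lemma Ind0 : set0 \in Ind G. Proof. by have [] := Ind_complex G. Qed.

Lemma Ind1 v : [set v] \in Ind G.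
Proof.
rewrite inE; apply/forall_inP => x /set1P->; apply/forall_inP => y /set1P->.
by rewrite edge_irr.
Qed.

Lemma Ind2 u v : ([set u; v] \in Ind G) = ~~ G u v.
Proof.
apply/idP/idP => [|nGuv].
  by rewrite inE => /forall_inP/(_ u (set21 _ _))/forall_inP/(_ v (set22 _ _)).
rewrite inE; apply/forall_inP => x xF; apply/forall_inP => y; move: x xF.
by move=> x /set2P[]-> /set2P[]->; rewrite ?edge_irr // edge_sym.
Qed.

Definition nonedges : {set {set 'I_n}} := [set F in Ind G | #|F| == 2].

Definition sigma1 : {mpoly k[n]} := \sum_i 'X_i.
Definition sigma2 : {mpoly k[n]} := \sum_(F in nonedges) \prod_(i in F) 'X_i.

Lemma restr_sigma1 F : restr F sigma1 = \sum_(i in F) 'X_i.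
Proof.
rewrite raddf_sum /= [RHS]big_mkcond; apply: eq_bigr => i _; exact: restrXi.
Qed.

Lemma restr_sigma1_neq0 F : F != set0 -> restr F sigma1 != 0.
Proof.
case/set0Pn => i Fi; apply/eqP => /(congr1 (mcoeff U_(i))).
rewrite restr_sigma1 mcoeff0 raddf_sum (bigD1 i) //= mcoeffXU eqxx big1 ?addr0.
  by move/eqP; rewrite oner_eq0.
by move=> j /andP[_ /negPf ji]; rewrite mcoeffXU ji.
Qed.

Lemma restr_sigma2 F : F \in nonedges -> restr F sigma2 = \prod_(i in F) 'X_i.
Proof.
move=> FE; rewrite raddf_sum (bigD1 F) //= [X in _ + X]big1 ?addr0 => [|H /andP[HE neHF]].
  by rewrite rmorph_prod; apply: eq_bigr => i Fi; rewrite /= restrXi Fi.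
have [i Hi Fi] : exists2 i, i \in H & i \notin F.
  apply/subsetPn; apply: contra neHF => HF; rewrite eqEcard HF.
  by move: HE FE; rewrite !inE => /andP[_ /eqP->] /andP[_ /eqP->].
by rewrite rmorph_prod (bigD1 i) //= restrXi (negPf Fi) mul0r.
Qed.

Lemma restr_restr F p : restr F (restr F p) = restr F p.
Proof. by apply/mpolyP => m; rewrite !mcoeff_restr; case: (_ \subset _). Qed.

(** Converse of [restr_edge_ideal]: each monomial with independent support is visible on some [F]
    where [p] vanishes. *)
Lemma edge_ideal_restr p :
  (forall H, H \in Ind G -> exists2 F : {set 'I_n}, H \subset F & restr F p = 0) -> p \in edge_ideal G.
Proof.
move=> p0; apply/edge_idealP => m /p0[F mF /(congr1 (mcoeff m))].
by rewrite mcoeff_restr mF mcoeff0.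
Qed.

(** On a nonempty face [sigma1] restricts to a nonzero element of a domain, and the nonempty faces
    cover all faces. *)
Lemma sigma1_regular p : (0 < n)%N -> sigma1 * p \in edge_ideal G -> p \in edge_ideal G.
Proof.
move=> n_gt0 p0; apply: edge_ideal_restr => H HG.
have [F [FG F0 HF]] : exists F, [/\ F \in Ind G, F != set0 & H \subset F].
  have [->|H0] := eqVneq H set0; last by exists H.
  exists [set Ordinal n_gt0]; split; [exact: Ind1 | | exact: sub0set].
  by apply/set0Pn; exists (Ordinal n_gt0); rewrite inE.
exists F => //; have /eqP := restr_edge_ideal FG p0.
by rewrite rmorphM mulf_eq0 /= (negPf (restr_sigma1_neq0 F0)) => /eqP.
Qed.

(** Substituting [- 'X_v] for ['X_u] changes any polynomial by a multiple of ['X_u + 'X_v]: this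
    holds for constants and variables and passes to sums and products. *)
Lemma dvd_X_add_X u v p :
    mmap (@mpolyC n k) (fun i => if i == u then - 'X_v else 'X_i) p = 0 ->
  exists c, p = ('X_u + 'X_v) * c.
Proof.
set f := mmap _ _ => fp0.
have fM q r : f (q * r) = f q * f r by exact: rmorphM.
have fD q r : f (q + r) = f q + f r by exact: raddfD.
have dvdM q r : (exists c, q - f q = ('X_u + 'X_v) * c) ->
    (exists c, r - f r = ('X_u + 'X_v) * c) ->
    exists c, q * r - f (q * r) = ('X_u + 'X_v) * c.
  move=> [c qE] [d rE]; exists (c * r + f q * d).
  by rewrite fM mulrDr mulrA -qE mulrCA -rE; ring.
have dvdC c : exists d, c%:MP - f c%:MP = ('X_u + 'X_v) * d.
  by exists 0; rewrite /f mmapC subrr mulr0.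
have dvdX i : exists d, 'X_i - f 'X_i = ('X_u + 'X_v) * d.
  rewrite /f mmapX mmap1U; case: eqP => [->|_]; first by exists 1; rewrite opprK mulr1.
  by exists 0; rewrite subrr mulr0.
suff [c] : exists c, p - f p = ('X_u + 'X_v) * c by rewrite fp0 subr0 => pE; exists c.
rewrite [p]mpolyE; elim/big_ind: _ => [|q r [c qE] [d rE]|m _].
- by rewrite -mpolyC0.
- by exists (c + d); rewrite fD mulrDr -qE -rE; ring.
rewrite -mul_mpolyC; apply: (dvdM) => //; rewrite mpolyXE_id.
apply: (big_ind (fun q => exists d, q - f q = ('X_u + 'X_v) * d)) => [|q r|i _].
- by rewrite -mpolyC1.
- exact: dvdM.
by elim: (m i) => [|e IHe]; rewrite ?expr0 -?mpolyC1 // exprS; apply: dvdM.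
Qed.

Lemma mcoeffMX_notin p u (m : 'X_{1..n}) : u \notin msupport m -> (p * 'X_u)@_m = 0.
Proof.
move=> um; have : restr (msupport m) (p * 'X_u) = 0.
  by rewrite rmorphM /= restrXi (negPf um) mulr0.
by move/(congr1 (mcoeff m)); rewrite mcoeff_restr subxx mcoeff0.
Qed.

Section GraphComplex.
Hypothesis n_gt0 : (0 < n)%N.
Hypothesis Ind_le2 : forall F, F \in Ind G -> (#|F| <= 2)%N.
Hypothesis nonadjacent_ex : forall v, exists w, nonadjacent v w.
Hypothesis nonadjacent_connected : forall v w, connect nonadjacent v w.

Lemma nonedgesP F : F \in nonedges ->
  exists u v, [/\ F = [set u; v], u != v & ~~ G u v].
Proof.
rewrite inE => /andP[FG /cards2P[u [v [ne_uv FE]]]]; exists u, v; split=> //.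
by rewrite -Ind2 // -FE.
Qed.

Lemma nonedge2 u v : nonadjacent u v -> [set u; v] \in nonedges.
Proof. by case/andP=> uv nG; rewrite inE Ind2 // nG cards2 uv. Qed.

Lemma Ind_sub_nonedge H : H \in Ind G -> exists2 F, F \in nonedges & H \subset F.
Proof.
move=> HG; have ex1 v : exists2 F, F \in nonedges & [set v] \subset F.
  by have [w /nonedge2 vw] := nonadjacent_ex v; exists [set v; w]; rewrite ?sub1set ?set21.
have := Ind_le2 HG; rewrite leq_eqVlt ltnS => /orP[H2|].
  by exists H => //; rewrite inE HG.
rewrite leq_eqVlt => /orP[/cards1P[v ->] // |].
rewrite ltnS leqn0 cards_eq0 => /eqP->.
by have [F FE _] := ex1 (Ordinal n_gt0); exists F => //; apply: sub0set.
Qed.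

(** On [F = [set u; v]] the relation reads ['X_u * 'X_v * a = ('X_u + 'X_v) * b] after restriction.
    Putting ['X_u := - 'X_v] kills the right side, so the restriction of [a] vanishes under this
    substitution. *)
Lemma restr_dvd_sigma1 a b F : sigma2 * a - sigma1 * b \in edge_ideal G ->
  F \in nonedges -> exists c, restr F a = restr F sigma1 * c.
Proof.
move=> abI FE; have [u [v [FuvE ne_uv nGuv]]] := nonedgesP FE.
have FG : F \in Ind G by move: FE; rewrite inE => /andP[].
have sumF : \sum_(i in F) 'X_i = 'X_u + 'X_v :> {mpoly k[n]}.
  by rewrite FuvE big_setU1 ?inE //= big_set1.
have prodF : \prod_(i in F) 'X_i = 'X_u * 'X_v :> {mpoly k[n]}.
  by rewrite FuvE big_setU1 ?inE //= big_set1.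
have abE : 'X_u * 'X_v * restr F a = ('X_u + 'X_v) * restr F b.
  have /eqP := restr_edge_ideal FG abI; rewrite raddfB /= subr_eq0 !rmorphM /=.
  by rewrite restr_sigma2 // restr_sigma1 sumF prodF => /eqP.
rewrite restr_sigma1 sumF; apply: dvd_X_add_X; set f := mmap _ _.
have fX i : f 'X_i = if i == u then - 'X_v else 'X_i by rewrite /f mmapX mmap1U.
have := congr1 f abE; rewrite /f !rmorphM rmorphD /= -/f !fX eqxx [v == u]eq_sym (negPf ne_uv).
rewrite addNr mul0r => /eqP; rewrite mulf_eq0 => /orP[|/eqP//].
rewrite mulf_eq0 oppr_eq0 orbb => /eqP/(congr1 (mcoeff U_(v))).
by rewrite mcoeffXU eqxx mcoeff0 => /eqP; rewrite oner_eq0.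
Qed.

(* The local quotients [c F] of [a] by [sigma1] agree on overlaps: on the
   coordinate axis of [v] they are read off from [a], and the constant terms agree
   by connectedness. *)
Lemma sigma2_regular a b : sigma2 * a - sigma1 * b \in edge_ideal G ->
  exists c, a - sigma1 * c \in edge_ideal G.
Proof.
move=> abI.
have /choice[c cE] F : exists c, F \in nonedges -> restr F a = restr F sigma1 * c.
  have [FE|_] := boolP (F \in nonedges); last by exists 0.
  by have [c] := restr_dvd_sigma1 abI FE; exists c.
have axis F v m : F \in nonedges -> v \in F -> msupport m \subset [set v] ->
    (c F)@_m = a@_(U_(v) + m).
  move=> FE Fv mv; have := congr1 (mcoeff (U_(v) + m)) (cE F FE).
  rewrite mcoeff_restr msupportD msupport1 subUset sub1set Fv (subset_trans mv) ?sub1set //= => ->.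
  rewrite restr_sigma1 (bigD1 v) //= mulrDl mcoeffD ['X_v * _]mulrC mcoeffMX mulr_suml raddf_sum /=.
  rewrite big1 ?addr0 // => u /andP[_ ne_uv]; rewrite mulrC mcoeffMX_notin //.
  rewrite msupportD msupport1 !inE negb_or ne_uv /=.
  by have /subsetP/(_ u) := mv; rewrite !inE (negPf ne_uv) => /contra; apply.
have const v w : a@_(U_(v)) = a@_(U_(w)).
  have step x y : nonadjacent x y -> a@_(U_(x)) = a@_(U_(y)).
    move=> /nonedge2 xyE; have ax z : z \in [set x; y] -> (c [set x; y])@_0 = a@_(U_(z) + 0).
      by move=> zxy; apply: (axis) => //; rewrite msupport0 sub0set.
    have := ax x; have := ax y.
    by rewrite !inE !eqxx orbT !addm0 => <- // <-.
  have /connectP[s] := nonadjacent_connected v w.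
  by elim: s v => [v _ -> // | x s IHs v /= /andP[/step-> ] /IHs].
(* The glued coefficient function; it is 0 on monomials supported on no face of size two. *)
pose g m := if [pick F in nonedges | msupport m \subset F] is Some F then (c F)@_m else 0.
have gE F m : F \in nonedges -> msupport m \subset F -> g m = (c F)@_m.
  move=> FE mF; rewrite /g; case: pickP => [H /andP[HE mH] | /(_ F)]; last by rewrite FE mF.
  have [[FG /eqP F2] [HG /eqP H2]] : (F \in Ind G /\ #|F| == 2) /\ (H \in Ind G /\ #|H| == 2).
    by move: FE HE; rewrite !inE => /andP[-> ->] /andP[-> ->].
  have [m2|m2] := leqP 2 #|msupport m|.
    have /eqP <- : msupport m == F by rewrite eqEcard mF F2.
    by have /eqP -> : msupport m == H by rewrite eqEcard mH H2.
  move: m2; rewrite ltnS leq_eqVlt => /orP[/cards1P[v mE] | ].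
    by rewrite !(axis _ v) // ?mE // -sub1set -mE.
  rewrite ltnS leqn0 cards_eq0 => /eqP m0.
  have [[v Fv] [w Hw]] : (exists v, v \in F) /\ (exists w, w \in H).
    by split; apply/set0Pn; rewrite -card_gt0 ?F2 ?H2.
  rewrite (axis F v) ?(axis H w) ?m0 ?sub0set //.
  suff -> : m = 0%MM by rewrite !addm0.
  by apply/mnmP => i; have /setP/(_ i) := m0; rewrite !inE mnm0E => /negbFE/eqP.
(* Every [c F] has degree below [K], so [g] vanishes from degree [K] on and is the coefficient
   function of a polynomial. *)
pose K := \max_F msize (c F).
pose d : {mpoly k[n]} := \sum_(m : 'X_{1..n < K}) g m *: 'X_[m].
have dE m : d@_m = g m.
  have [mK|mK] := ltnP (mdeg m) K; first exact: mcoeff_mpoly.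
  rewrite /d raddf_sum big1 => [|l _]; last first.
    rewrite /= mcoeffZ mcoeffX; case: eqP => [lm|]; last by rewrite mulr0.
    by have := bmdeg l; rewrite lm ltnNge mK.
  rewrite /g; case: pickP => // F _; rewrite mcoeff_msize_le //.
  by apply: leq_trans mK; apply: (@leq_bigmax _ (fun F => msize (c F))).
exists d; apply: edge_ideal_restr => H /Ind_sub_nonedge[F FE HF]; exists F => //.
have -> : restr F (a - sigma1 * d) = restr F a - restr F sigma1 * restr F d.
  by rewrite raddfB /= rmorphM.
have -> : restr F d = restr F (c F).
  by apply/mpolyP => m; rewrite !mcoeff_restr dE; case: ifP => // /gE->.
by rewrite -(restr_restr F a) -(restr_restr F sigma1) cE // rmorphM /= subrr.
Qed.
End GraphComplex.
End RegularElements.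

(** * Sufficient and necessary conditions for Cohen-Macaulayness *)

Section DepthCriteria.
Local Open Scope ring_scope.
Variables (k : fieldType) (n : nat) (G : sgraph n).
Local Notation pi := (@to_edge_ring k n G).

Lemma sigma1_irrelevant : sigma1 k n \in @irrelevant_ideal k n.
Proof.
apply: ideal_sum => [|i _]; first exact: ideal_gen_ideal.
by apply/mem_ideal_gen/map_f; rewrite mem_enum.
Qed.

Lemma sigma2_irrelevant : sigma2 k G \in @irrelevant_ideal k n.
Proof.
apply: ideal_sum => [|F]; first exact: ideal_gen_ideal.
rewrite inE => /andP[_ F2].
have /set0Pn[i Fi] : F != set0 by rewrite -card_gt0 (eqP F2).
rewrite (bigD1 i) //=; apply: ideal_mulr; first exact: ideal_gen_ideal.
by apply/mem_ideal_gen/map_f; rewrite mem_enum.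
Qed.

(** The coordinate prime of the empty face contains the classes of all variables and omits 1. *)
Lemma irrelevant_proper (s : seq {mpoly k[n]}) :
  {subset s <= @irrelevant_ideal k n} -> 1 \notin ideal_gen (map pi s).
Proof.
move=> sI; have [clP _] := coordinate_prime_prime k (Ind0 G).
have [_ P1 _] := clP; apply: contra P1; apply: ideal_gen_sub; first exact: idealr_closedW.
move=> _ /mapP[p /sI pI ->]; rewrite coordinate_primeE ?Ind0 //; move: p pI.
suff sub : {subset @irrelevant_ideal k n <= [pred p | restr set0 p == 0]} by move=> p /sub.
apply: ideal_gen_sub => [|_ /mapP[i _ ->]]; last by rewrite inE restrXi inE.
split=> [|a u v]; rewrite !inE; first by rewrite raddf0.
by move=> /eqP u0 /eqP v0; rewrite raddfD /= rmorphM /= u0 v0 mulr0 addr0.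
Qed.

Lemma sigma1_nonzerodivisor a : (0 < n)%N ->
  pi (sigma1 k n) * a \in ideal_gen [::] -> a \in ideal_gen [::].
Proof.
move=> n_gt0; have [p ->] := to_edge_ring_surj a.
by rewrite !ideal_gen_nil !inE -rmorphM !to_edge_ring_eq0; apply: sigma1_regular.
Qed.

Lemma CohenMacaulay_complete : (0 < n)%N ->
  (forall F, F \in Ind G -> (#|F| <= 1)%N) -> CohenMacaulay k G.
Proof.
move=> n_gt0 le1.
apply: (@CohenMacaulay_regular_seq k n G 1 [set Ordinal n_gt0] [:: sigma1 k n]) => //.
- exact: Ind1.
- exact: cards1.
split=> [p|]; first by rewrite inE => /eqP->; apply: sigma1_irrelevant.
split=> [[|//] _ a|]; first by rewrite take0; apply: sigma1_nonzerodivisor.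
by apply: irrelevant_proper => p; rewrite inE => /eqP->; apply: sigma1_irrelevant.
Qed.

Lemma CohenMacaulay_connected_graph : (0 < n)%N ->
    (forall F, F \in Ind G -> (#|F| <= 2)%N) ->
    (forall v, exists w, nonadjacent G v w) ->
    (forall v w, connect (nonadjacent G) v w) ->
  CohenMacaulay k G.
Proof.
move=> n_gt0 le2 nonadj conn; have [w vw] := nonadj (Ordinal n_gt0).
have irr : {subset [:: sigma1 k n; sigma2 k G] <= @irrelevant_ideal k n}.
  by move=> p; rewrite !inE => /orP[]/eqP->; [apply: sigma1_irrelevant | apply: sigma2_irrelevant].
have := nonedge2 vw; rewrite inE => /andP[vwG /eqP vw2].
apply: (CohenMacaulay_regular_seq (s := [:: sigma1 k n; sigma2 k G]) vwG vw2) => //.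
split=> //; split; last exact: irrelevant_proper.
move=> [|[|//]] _ a; first by rewrite take0; apply: sigma1_nonzerodivisor.
have [p ->] := to_edge_ring_surj a => /= abI.
have lt02 : (0 < size (map pi [:: sigma1 k n; sigma2 k G]))%N by [].
have [b] := ideal_gen_takeSE lt02 abI.
have [q ->] := to_edge_ring_surj b.
rewrite take0 ideal_gen_nil inE /= -!rmorphM -raddfB to_edge_ring_eq0 /= [q * _]mulrC.
case/(sigma2_regular n_gt0 le2 nonadj conn) => c.
rewrite -to_edge_ring_eq rmorphM => /eqP->; apply: ideal_mulr; first exact: ideal_gen_ideal.
by apply: mem_ideal_gen; rewrite inE.
Qed.

Lemma irrelevant_linear_combination p : p \in @irrelevant_ideal k n ->
  exists c : 'I_n -> {mpoly k[n]}, p = \sum_i c i * 'X_i.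
Proof.
pose J := [pred p : {mpoly k[n]} | `[< exists c : 'I_n -> {mpoly k[n]}, p = \sum_i c i * 'X_i >]].
suff /(_ p) : {subset @irrelevant_ideal k n <= J} by rewrite inE => sub /sub/asboolP.
apply: ideal_gen_sub => [|_ /mapP[i _ ->]].
  split=> [|a u v]; rewrite !inE.
    by apply/asboolP; exists (fun=> 0); rewrite big1 // => i _; rewrite mul0r.
  move=> /asboolP[c ->] /asboolP[d ->]; apply/asboolP; exists (fun i => a * c i + d i).
  by rewrite mulr_sumr -big_split; apply: eq_bigr => i _; rewrite mulrDl mulrA.
rewrite inE; apply/asboolP; exists (fun j => (j == i)%:R).
by rewrite (bigD1 i) //= eqxx mul1r big1 ?addr0 // => j /negPf->; rewrite mul0r.
Qed.

Lemma edge_regular_seq_combination (s : seq {mpoly k[n]}) : edge_regular_seq G s ->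
  forall f, f \in map pi s -> exists c : 'I_n -> edge_ring k G, f = \sum_i c i * pi 'X_i.
Proof.
case=> sI _ _ /mapP[p /sI/irrelevant_linear_combination[c ->] ->].
exists (fun i => pi (c i)); rewrite raddf_sum; apply: eq_bigr => i _.
by rewrite /= rmorphM.
Qed.

Lemma mpolyX_edge i j : G i j -> 'X_i * 'X_j \in @edge_ideal k n G.
Proof. by move=> Gij; apply/mem_ideal_gen/mapP; exists (i, j); rewrite ?mem_enum. Qed.

(** The cochain [c v *: 'X_v] is a Koszul cocycle, since ['X_j * 'X_l] vanishes on edges and [c]
    agrees on nonedges. Depth at least 2 writes it as ['X_v * z], and comparing coefficients at
    ['X_v] makes [c v] the constant term of [z]. *)
Lemma CohenMacaulay_locally_constant F (c : 'I_n -> k) :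
    CohenMacaulay k G -> F \in Ind G -> (1 < #|F|)%N ->
    (forall u v, nonadjacent G u v -> c u = c v) ->
  forall u v, c u = c v.
Proof.
move=> CMG FG F_gt1 cst; have [s reg_s Fs] := CohenMacaulay_depth CMG FG.
have sz_s : (1 < size (map pi s))%N by rewrite size_map (leq_trans F_gt1).
have [_ reg_t] := reg_s.
have [j l|z zE] := @koszul_acyclic1 _ _ (fun i => pi 'X_i) _ reg_t
    (edge_regular_seq_combination reg_s) 0 (fun v => pi (c v *: 'X_v)) sz_s.
  rewrite take0 ideal_gen_nil inE -!rmorphM -raddfB to_edge_ring_eq0 /=.
  rewrite -!scalerAr [_ * 'X_j]mulrC -scalerBl -mul_mpolyC.
  have [Gjl|nGjl] := boolP (G j l); first exact/ideal_mull/mpolyX_edge/Gjl/ideal_gen_ideal.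
  suff -> : c l = c j by rewrite subrr mpolyC0 mul0r; case: (ideal_gen_ideal (edge_monomials k G)).
  by have [->//|ne_jl] := eqVneq l j; apply/esym/cst; rewrite /nonadjacent eq_sym ne_jl.
have [q zq] := to_edge_ring_surj z.
suff cE v : c v = q@_0%MM by move=> u v; rewrite !cE.
have := zE v; rewrite take0 ideal_gen_nil inE zq -rmorphM -raddfB to_edge_ring_eq0 /=.
move/edge_idealP/(_ (U_(v) + 0)%MM); rewrite addm0 msupport1 => /(_ (Ind1 G v))/eqP.
rewrite mcoeffB mcoeffZ mcoeffXU eqxx mulr1 mulrC.
by have := mcoeffMX q U_(v)%MM 0%MM; rewrite addm0 => ->; rewrite subr_eq0 => /eqP.
Qed.

(** The same argument one degree higher, with the cochain [phi u v *: ('X_u * 'X_v)] and depth at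
    least 3. The potential [psi v] is the coefficient of ['X_v] in the [v]-th entry of the
    primitive. *)
Lemma CohenMacaulay_coboundary F (phi : 'I_n -> 'I_n -> k) :
    CohenMacaulay k G -> F \in Ind G -> (2 < #|F|)%N ->
    (forall u, phi u u = 0) -> (forall u v, phi v u = - phi u v) ->
    (forall u v w, nonadjacent G u v -> nonadjacent G u w -> nonadjacent G v w ->
      phi v w - phi u w + phi u v = 0) ->
  exists psi : 'I_n -> k, forall u v, nonadjacent G u v -> phi u v = psi v - psi u.
Proof.
move=> CMG FG F_gt2 phi0 phiN cocycle; have [s reg_s Fs] := CohenMacaulay_depth CMG FG.
have sz_s : (2 < size (map pi s))%N by rewrite size_map (leq_trans F_gt2).
have [_ reg_t] := reg_s.
have clI := ideal_gen_ideal (edge_monomials k G).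
have [h j l|z zE] := @koszul_acyclic2 _ _ (fun i => pi 'X_i) _ reg_t
    (edge_regular_seq_combination reg_s) 0 (fun u v => pi (phi u v *: ('X_u * 'X_v))) sz_s.
  rewrite take0 ideal_gen_nil inE -!rmorphM -raddfB -raddfD to_edge_ring_eq0 /=.
  rewrite (_ : _ + _ = (phi j l - phi h l + phi h j)%:MP * ('X_h * 'X_j * 'X_l)); last first.
    by rewrite -!mul_mpolyC mpolyCD mpolyCB; ring.
  (* An edge among [h], [j], [l] kills the monomial; otherwise the scalar vanishes, by antisymmetry
     when two indices coincide and by the cocycle condition when they are distinct. *)
  have [Ghj|nGhj] := boolP (G h j).
    by rewrite mulrA; apply: (ideal_mulr clI); apply: (ideal_mull clI); apply: mpolyX_edge.
  have [Gjl|nGjl] := boolP (G j l).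
    by rewrite -mulrA; apply: (ideal_mull clI); apply: (ideal_mull clI); apply: mpolyX_edge.
  have [Ghl|nGhl] := boolP (G h l).
    by rewrite mulrAC; apply: (ideal_mull clI); apply: (ideal_mulr clI); apply: mpolyX_edge.
  suff -> : phi j l - phi h l + phi h j = 0.
    by rewrite mpolyC0 mul0r; case: clI.
  have [->|ne_hj] := eqVneq h j; first by rewrite phi0 subrr add0r.
  have [->|ne_jl] := eqVneq j l; first by rewrite phi0 sub0r addNr.
  have [->|ne_hl] := eqVneq h l; first by rewrite phi0 subr0 [phi l j]phiN addrN.
  by apply: cocycle; rewrite /nonadjacent ?ne_hj ?ne_jl ?ne_hl.
have /choice[q zq] v : exists p, z v = pi p by apply: to_edge_ring_surj.
exists (fun v => (q v)@_U_(v)) => u v uv.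
have := zE u v; rewrite take0 ideal_gen_nil inE !zq -!rmorphM -!raddfB to_edge_ring_eq0 /=.
move/edge_idealP/(_ (U_(u) + U_(v))%MM); rewrite msupportD !msupport1.
have := nonedge2 uv; rewrite inE => /andP[-> _] /(_ isT).
rewrite !mcoeffB mcoeffZ -mpolyXD mcoeffX eqxx mulr1 !['X_ _ * _]mulrC.
rewrite mcoeffMX [(U_(u) + U_(v))%MM]addmC mcoeffMX => /eqP.
by rewrite subr_eq0 => /eqP.
Qed.
End DepthCriteria.

(** * Reduced homology in degrees at most 0 *)

Section LowHomology.
Local Open Scope ring_scope.
Variables (k : fieldType) (n : nat) (Delta : {set {set 'I_n}}).
Implicit Types (F H : {set 'I_n}) (c : chain_space k n).

Lemma boundary_face_vec F : boundary k n (face_vec k F) = face_boundary k F.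
Proof.
rewrite lfunE /= /boundary_fun (bigD1 F) //= ffunE eqxx scale1r big1 ?addr0 // => H /negPf neHF.
by rewrite ffunE neHF scale0r.
Qed.

Lemma face_boundary1 (v : 'I_n) : face_boundary k [set v] = face_vec k set0.
Proof.
rewrite /face_boundary big_set1 setDv (_ : [set y in _ | _] = set0) ?cards0 ?scale1r //.
by apply/setP => y; rewrite !inE; case: eqP => // ->; rewrite ltnn.
Qed.

Lemma face_boundary2 (u v : 'I_n) : (u < v)%N ->
  face_boundary k [set u; v] = face_vec k [set v] - face_vec k [set u].
Proof.
move=> lt_uv; have ne_uv : u != v by rewrite -val_eqE neq_ltn lt_uv.
rewrite /face_boundary big_setU1 ?inE //= big_set1.
rewrite (_ : [set y in [set u; v] | (y < u)%N] = set0); last first.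
  by apply/setP => y; rewrite !inE -!val_eqE /=; lia.
rewrite (_ : [set y in [set u; v] | (y < v)%N] = [set u]); last first.
  by apply/setP => y; rewrite !inE -!val_eqE /=; lia.
rewrite cards0 cards1 scale1r expr1 scaleN1r setU1K ?inE //.
by rewrite setUC setU1K // inE eq_sym.
Qed.

Lemma chains_support i c F : c \in chains k Delta i ->
  ~~ ((F \in Delta) && (face_dim F == i)) -> c F = 0.
Proof.
rewrite /chains; set X := [seq _ | _ <- _ & _].
move=> /(@coord_span _ _ _ (in_tuple X)) -> nF; rewrite sum_ffunE big1 // => j _.
rewrite ffunE; have : (in_tuple X)`_j \in X by apply: mem_nth.
case/mapP => H; rewrite mem_filter mem_enum => /andP[Hi HD] ->; rewrite ffunE.
have [FH|_] := eqVneq F H; last by rewrite scaler0.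
by rewrite FH HD Hi in nF.
Qed.

Lemma face_vec_chains F : F \in Delta -> face_vec k F \in chains k Delta (face_dim F).
Proof. by move=> FD; apply/memv_span/map_f; rewrite mem_filter mem_enum FD eqxx. Qed.

Lemma chainE c : c = \sum_F c F *: face_vec k F.
Proof.
apply/ffunP => H; rewrite sum_ffunE (bigD1 H) //= !ffunE eqxx big1 ?addr0; first by rewrite [RHS]mulr1.
by move=> F /negPf neFH; rewrite !ffunE eq_sym neFH scaler0.
Qed.

Lemma reduced_homology_eq0 i :
  (forall c, c \in cycles k Delta i -> c \in boundaries k Delta i) ->
  reduced_homology k Delta i = 0%VS.
Proof. by move=> cb; apply/eqP; rewrite diffv_eq0; apply/subvP. Qed.

Lemma reduced_homology_lt i : i < -1 -> reduced_homology k Delta i = 0%VS.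
Proof.
move=> i_lt; apply: reduced_homology_eq0 => c; rewrite memv_cap => /andP[_ ci].
rewrite (chainE c); apply: memv_suml => F _; rewrite (chains_support ci) ?scale0r ?mem0v //.
by rewrite negb_and; apply/orP; right; rewrite /face_dim; lia.
Qed.

Lemma reduced_homologyN1 (v : 'I_n) : [set v] \in Delta -> reduced_homology k Delta (-1) = 0%VS.
Proof.
move=> vD; apply: reduced_homology_eq0 => c; rewrite memv_cap => /andP[_ cN1].
rewrite (chainE c); apply: memv_suml => F _.
have [->|F0] := eqVneq F set0.
  rewrite -(face_boundary1 v) -boundary_face_vec; apply/memvZ/memv_img.
  by rewrite (_ : -1 + 1 = face_dim [set v]) ?face_vec_chains // /face_dim cards1.
rewrite (chains_support cN1) ?scale0r ?mem0v // negb_and; apply/orP; right.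
by rewrite -card_gt0 in F0; rewrite /face_dim; lia.
Qed.

(** A 0-cycle has coefficient sum 0, so it is a combination of differences of vertices, and each
    difference bounds a path. Steps with [a = b] in the relation contribute 0. *)
Lemma reduced_homology0 :
    (forall v w : 'I_n, [set v] \in Delta -> [set w] \in Delta ->
      connect (fun a b => [set a; b] \in Delta) v w) ->
  reduced_homology k Delta 0 = 0%VS.
Proof.
move=> conn; apply: reduced_homology_eq0 => c; rewrite memv_cap => /andP[/[!memv_ker] /eqP c0 c_chain].
have edge_bd a b : [set a; b] \in Delta ->
    face_vec k [set b] - face_vec k [set a] \in boundaries k Delta 0.
  have lt_bd (x y : 'I_n) : (x < y)%N -> [set x; y] \in Delta ->
      face_vec k [set y] - face_vec k [set x] \in boundaries k Delta 0.
    move=> ltxy xyD; rewrite -face_boundary2 // -boundary_face_vec; apply/memv_img.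
    rewrite (_ : 0 + 1 = face_dim [set x; y]) ?face_vec_chains // /face_dim cards2.
    by rewrite -val_eqE /=; lia.
  case: (ltngtP a b) => [ltab|ltba|/val_inj ->].
  - exact: lt_bd.
  - by rewrite setUC -opprB memvN => /lt_bd; apply.
  - by rewrite subrr mem0v.
have path_bd a b : connect (fun a b => [set a; b] \in Delta) a b ->
    face_vec k [set b] - face_vec k [set a] \in boundaries k Delta 0.
  case/connectP => s; elim: s a => [a _ ->|x s IHs a /= /andP[axD /IHs + bE]].
    by rewrite subrr mem0v.
  move=> /(_ bE) xb.
  rewrite (_ : _ - _ = (face_vec k [set b] - face_vec k [set x]) + (face_vec k [set x] - face_vec k [set a])).
    by apply: memvD => //; apply: edge_bd.
  by rewrite addrA subrK.
have c_vertex F : c F != 0 -> exists2 v, F = [set v] & F \in Delta.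
  move=> cF; have : (F \in Delta) && (face_dim F == 0).
    by apply: contraNT cF => /(chains_support c_chain) ->.
  case/andP=> FD F1; have /cards1P[v Fv] : #|F| == 1%N by move: F1; rewrite /face_dim; lia.
  by exists v.
have [/existsP[F0 cF0]|] := boolP [exists F, c F != 0]; last first.
  rewrite negb_exists => /forallP noF; rewrite (chainE c); apply: memv_suml => F _.
  by have := noF F; rewrite negbK => /eqP->; rewrite scale0r mem0v.
have [v0 F0E v0D] := c_vertex _ cF0; rewrite F0E in v0D.
(* The value of the boundary at the empty face is the augmentation. *)
have sum0 : \sum_F c F = 0.
  have := congr1 (fun d : chain_space k n => d set0) c0.
  rewrite lfunE /= /boundary_fun sum_ffunE [RHS]ffunE => sc0; rewrite -[RHS]sc0.
  apply: eq_bigr => F _; rewrite ffunE.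
  have [->|/c_vertex[v -> _]] := eqVneq (c F) 0; first by rewrite scale0r.
  by rewrite face_boundary1 ffunE eqxx [RHS]mulr1.
have -> : c = \sum_F c F *: (face_vec k F - face_vec k [set v0]).
  under eq_bigr do rewrite scalerBr.
  by rewrite sumrB -chainE -scaler_suml sum0 scale0r subr0.
apply: memv_suml => F _.
have [->|/c_vertex[v -> vD]] := eqVneq (c F) 0; first by rewrite scale0r mem0v.
exact/memvZ/path_bd/conn.
Qed.
End LowHomology.

(** * The Buchsbaum property in dimension at most two *)

Section BuchsbaumDimTwo.
Local Open Scope ring_scope.
Variables (k : fieldType) (n : nat) (G : sgraph n).

Lemma link_card_gt (F : {set 'I_n}) r : r%:Z - 1 < complex_dim (link (Ind G) F) ->
  exists2 H, H \in link (Ind G) F & (r < #|H|)%N.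
Proof.
rewrite /complex_dim => lt_r; apply/exists_inP; apply: contraLR lt_r.
rewrite negb_exists_in => /forall_inP small; rewrite -leNgt.
suff : (\max_(H in link (Ind G) F) #|H| <= r)%N by lia.
by apply/bigmax_leqP => H /small; rewrite -leqNgt.
Qed.

Lemma link_sub (F H K : {set 'I_n}) : F \in Ind G -> H \in link (Ind G) F -> K \subset H ->
  K \in link (Ind G) F.
Proof. by move=> FG; have [_] := link_complex (Ind_complex G) FG; apply. Qed.

(** Links of nonempty faces have faces of at most two vertices, so only degrees up to 0 lie below
    their dimension. Degree 0 does so only if [F] is a vertex, and there connectedness suffices. *)
Lemma Buchsbaum_of_connected_links :
    pure (Ind G) -> (forall F, F \in Ind G -> (#|F| <= 3)%N) ->
    (forall v a b, nonadjacent G v a -> nonadjacent G v b ->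
      connect (fun x y => [set x; y] \in link (Ind G) [set v]) a b) ->
  Buchsbaum k G.
Proof.
move=> pureG le3 conn; split=> // F FG F0 i.
have [i_lt _|i_ge] := ltP i (-1); first exact: reduced_homology_lt.
(* The number [r] is the size of an [i]-dimensional face. *)
have [r ->] : exists r : nat, i = r%:Z - 1 by exists (absz (i + 1)); lia.
move=> /link_card_gt[H HF rH].
case: r rH => [|[|r]] rH.
- have /card_gt0P[v Hv] := rH; apply: (@reduced_homologyN1 _ _ _ v).
  by apply: link_sub HF _ => //; rewrite sub1set.
- apply: reduced_homology0 => a b aF bF.
  have /cards1P[v Fv] : #|F| == 1%N.
    have := HF; rewrite inE => /and3P[_ dFH /le3]; rewrite cardsU disjoint_setI0 // cards0.
    by rewrite -card_gt0 in F0; lia.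
  have nonadj x : [set x] \in link (Ind G) F -> nonadjacent G v x.
    rewrite inE Fv disjoints1 inE => /and3P[_ ne_vx].
    by rewrite /nonadjacent ne_vx -Ind2.
  by rewrite Fv; apply: conn; apply: nonadj.
have := HF; rewrite inE => /and3P[_ dFH /le3]; rewrite cardsU disjoint_setI0 // cards0.
by rewrite -card_gt0 in F0; lia.
Qed.

Lemma pure_of_extension r : (forall F, F \in Ind G -> (#|F| <= r)%N) ->
    (forall F, F \in Ind G -> (#|F| < r)%N -> exists2 v, v \notin F & v |: F \in Ind G) ->
  pure (Ind G).
Proof.
move=> le_r ext; suff facet_card F : facet (Ind G) F -> #|F| = r.
  by move=> F H /facet_card Fr /facet_card Hr; rewrite /face_dim Fr Hr.
case/maxsetP => FG maxF; apply/eqP; rewrite eqn_leq le_r //= leqNgt; apply/negP => F_lt.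
by have [v /negP vF /maxF/(_ (subsetUr _ _)) vFE] := ext F FG F_lt; apply: vF; rewrite -vFE setU11.
Qed.
End BuchsbaumDimTwo.

(** * Independent sets of circulant graphs *)

Section CirculantCombinatorics.
Variables (n d : nat).
Local Notation G := (circulant n (iota 1 d)).

(** Both arcs between the two vertices are longer than [d]; truncated subtraction is avoided for the
    sake of [lia]. *)
Lemma circulant_nonadjacent (u v : 'I_n) :
  nonadjacent G u v = ((u + d < v) && (v + d < u + n)) || ((v + d < u) && (u + d < v + n)).
Proof.
rewrite /nonadjacent /= /circulant_rel mem_iota /absdiff -val_eqE /=.
by move: (ltn_ord u) (ltn_ord v); lia.
Qed.

Lemma Ind_circulantP (F : {set 'I_n}) :
  reflect {in F &, forall u v, u != v -> nonadjacent G u v} (F \in Ind G).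
Proof.
rewrite inE; apply: (iffP forall_inP) => [FG u v uF vF ne_uv | FG u uF].
  by rewrite /nonadjacent ne_uv; have /forall_inP := FG u uF; apply.
apply/forall_inP => v vF; have [->|/(FG u v uF vF)/andP[]//] := eqVneq u v.
by rewrite edge_irr.
Qed.

Lemma nonadjacentC (u v : 'I_n) : nonadjacent G u v = nonadjacent G v u.
Proof. by rewrite /nonadjacent eq_sym edge_sym. Qed.

(** The arcs of [d.+1] consecutive vertices starting at the elements of [F] are pairwise
    disjoint. *)
Lemma Ind_circulant_card (F : {set 'I_n}) : (d < n)%N -> F \in Ind G -> (#|F| * d.+1 <= n)%N.
Proof.
move=> lt_dn /Ind_circulantP FG; have n_gt0 := leq_ltn_trans (leq0n d) lt_dn.
pose f (x : 'I_n * 'I_d.+1) : 'I_n :=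
  Ordinal (ltn_pmod (x.1 + x.2) n_gt0).
have fE x : f x = x.1 + x.2 :> nat \/ (f x + n = x.1 + x.2)%N.
  move: (ltn_ord x.1) (ltn_ord x.2) => lt1 lt2.
  have [lt_n|le_n] := ltnP (x.1 + x.2) n; first by left; rewrite /= modn_small.
  by right; rewrite /= -{1}(subnK le_n) modnDr modn_small; lia.
rewrite -{1}(card_ord d.+1) -cardsT -cardsX -[X in (_ <= X)%N]card_ord -(card_in_imset (f := f)).
  exact: max_card.
move=> [u i] [v j] /setXP[/= uF _] /setXP[/= vF _] eq_f.
have ui := fE (u, i); have vj := fE (v, j); rewrite eq_f /= in ui vj.
move: (ltn_ord i) (ltn_ord j) (ltn_ord u) (ltn_ord v).
have [eq_uv|ne_uv] := eqVneq u v.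
  move=> *; congr (_, _); apply: val_inj; rewrite ?eq_uv //=; move: ui vj; rewrite /= eq_uv; lia.
by have := FG u v uF vF ne_uv; rewrite circulant_nonadjacent; move: ui vj => /=; lia.
Qed.

(** Addition modulo [n] as two linear alternatives, in a form usable by [lia]. *)
Lemma rotate (v : 'I_n) c : (c <= n)%N -> exists w : 'I_n, (w = v + c :> nat \/ w + n = v + c)%N.
Proof.
move=> le_cn; have ltvn := ltn_ord v.
have [lt_n|le_n] := ltnP (v + c) n; first by exists (Ordinal lt_n); left.
have ltw : (v + c - n < n)%N by lia.
by exists (Ordinal ltw); right; rewrite /= subnK.
Qed.
End CirculantCombinatorics.

(** * The circulant graph in each range of [n] *)

Section Cases.
Variables (k : fieldType) (n d : nat).
Hypothesis d_gt0 : (0 < d)%N.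
Local Notation G := (circulant n (iota 1 d)).

Lemma circulant_complete_CM : (2 * d <= n)%N -> (n < 2 * d + 2)%N -> CohenMacaulay k G.
Proof.
move=> le_n lt_n; apply: CohenMacaulay_complete => [|F FG]; first by lia.
have lt_dn : (d < n)%N by lia.
by have := Ind_circulant_card lt_dn FG; case: #|F| => [|[|m]] //; nia.
Qed.

Lemma circulant_graph_CM : (2 * d + 3 <= n)%N -> (n <= 3 * d + 2)%N -> CohenMacaulay k G.
Proof.
move=> le_n le_n'; have lt_dn : (d < n)%N by lia.
apply: CohenMacaulay_connected_graph => [|F FG|v|].
- by lia.
- by have := Ind_circulant_card lt_dn FG; case: #|F| => [|[|[|m]]] //; nia.
- have [|w vw] := @rotate n v d.+1; first by lia.
  by exists w; rewrite circulant_nonadjacent; move: (ltn_ord v) (ltn_ord w); lia.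
have sym := sym_connect_sym (@nonadjacentC n d).
(* The vertex [v + d + 2] is at distance at least [d + 1] from both [v] and [v + 1], because [n] is
   at least [2 * d + 3]. *)
have step (v w : 'I_n) : w = v.+1 :> nat -> connect (nonadjacent G) v w.
  move=> wE; have [|x vx] := @rotate n v d.+2; first by lia.
  apply: (connect_trans (y := x)); apply: connect1; rewrite circulant_nonadjacent;
  move: (ltn_ord v) (ltn_ord w) (ltn_ord x); lia.
have from0 (v w : 'I_n) : v = 0%N :> nat -> connect (nonadjacent G) v w.
  move=> v0; have [m wm] : exists m, w = m :> nat by exists w.
  elim: m w wm => [|m IHm] w wm; first by rewrite (_ : w = v) //; apply: val_inj; rewrite /= wm.
  have lt_m : (m < n)%N by move: (ltn_ord w); lia.
  exact: connect_trans (IHm (Ordinal lt_m) erefl) (step (Ordinal lt_m) w wm).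
move=> v w; have n_gt0 : (0 < n)%N by lia.
by apply: (connect_trans (y := Ordinal n_gt0)); [rewrite sym from0 | apply: from0].
Qed.

(** With [s.+1 = n %/ d.+1], the first [s.+1] multiples of [d.+1] are independent, while [s]
    vertices with gaps between [d + 1] and [2 * d + 1] form a facet. *)
Lemma circulant_not_pure : (3 * d + 3 <= n)%N -> n <> (4 * d + 3)%N -> ~ pure (Ind G).
Proof.
move=> le_n ne_n pureG; have n_gt0 : (0 < n)%N by lia.
pose t := (n %/ d.+1)%N; pose s := t.-1.
have le_t : (t * d.+1 <= n)%N by apply: leq_trunc_div.
have lt_t : (n < t.+1 * d.+1)%N by rewrite /t ltn_ceil.
have t_ge3 : (2 < t)%N by rewrite /t leq_divRL; lia.
have tE : t = s.+1 by rewrite /s; lia.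
(* There must be room for [s] gaps of at most [2 * d + 1]. For [s = 2] the bound [n < 4 * d + 4]
   leaves only [4 * d + 3] to exclude; for larger [s] it follows from [n < (s + 2) * (d + 1)]. *)
have le_s : (n <= s * (2 * d).+1)%N.
  have [s2|s_ge3] : s = 2 \/ (3 <= s)%N by lia.
    by move: lt_t; rewrite tE s2; lia.
  have [m sE] : exists m, s = m.+3 by exists (s - 3)%N; lia.
  by move: lt_t; rewrite tE sE /=; nia.
clearbody t s; subst t.
have lt1 (q : 'I_s.+1) : (q * d.+1 < n)%N.
  by apply: leq_trans le_t; rewrite ltn_pmul2r.
pose A := [set Ordinal (lt1 q) | q : 'I_s.+1].
have AG : A \in Ind G.
  apply/Ind_circulantP => _ _ /imsetP[p _ ->] /imsetP[q _ ->].
  rewrite -val_eqE circulant_nonadjacent /= eqn_pmul2r // => ne_pq.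
  have sep (x y : 'I_s.+1) : (x < y)%N -> (x * d.+1 + d < y * d.+1)%N && (y * d.+1 + d < x * d.+1 + n)%N.
    move=> lt_xy; have le_y : (x.+1 * d.+1 <= y * d.+1)%N by rewrite leq_mul2r lt_xy orbT.
    have le_ys : (y.+1 * d.+1 <= s.+1 * d.+1)%N by rewrite leq_mul2r ltn_ord orbT.
    by move: le_y le_ys; rewrite !mulSn; lia.
  by move: ne_pq; rewrite neq_ltn => /orP[] /sep ->; rewrite ?orbT.
have cardA : #|A| = s.+1.
  rewrite card_imset ?card_ord // => p q /(congr1 val) /= /eqP.
  by rewrite eqn_pmul2r // => /eqP/val_inj.
(* The larger of two progressions: one starts at 0 with step [d + 1], the other reaches [n] at
   [q = s] with step [2 * d + 1]. *)
pose f q := maxn (q * d.+1) (n - (s - q) * (2 * d).+1).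
have f0 : f 0%N = 0%N by rewrite /f subn0 mul0n max0n; apply/eqP; rewrite subn_eq0.
have fs : f s = n by rewrite /f subnn mul0n subn0; move: le_t; rewrite mulSn; lia.
have fS q : (q < s)%N -> (f q + d < f q.+1)%N /\ (f q.+1 <= f q + (2 * d).+1)%N.
  move=> lt_qs; rewrite /f mulSn; have -> : (s - q = (s - q.+1).+1)%N by lia.
  by rewrite mulSn; lia.
have f_sep p q : (p < q <= s)%N -> (f p + d < f q)%N.
  case/andP; elim: q => // q IHq; rewrite ltnS leq_eqVlt => /orP[/eqP->|lt_pq] lt_qs.
    by have [] := fS q lt_qs.
  by have [] := fS q lt_qs; have := IHq lt_pq (ltnW lt_qs); lia.
have f_lt q : (q < s)%N -> (f q < n)%N.
  by move=> lt_qs; have := f_sep q s; rewrite lt_qs leqnn fs => /(_ isT); lia.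
pose B := [set Ordinal (f_lt q (ltn_ord q)) | q : 'I_s].
have cardB : (#|B| <= s)%N by rewrite (leq_trans (leq_imset_card _ _)) // card_ord.
have s_gt0 : (0 < s)%N by lia.
have BG : B \in Ind G.
  apply/Ind_circulantP => _ _ /imsetP[p _ ->] /imsetP[q _ ->].
  rewrite -val_eqE circulant_nonadjacent /=.
  have sep (x y : 'I_s) : (x < y)%N -> (f x + d < f y)%N && (f y + d < f x + n)%N.
    move=> lt_xy; have lt_ys := ltn_ord y; have := f_sep x y; have := f_sep y s.
    by rewrite lt_xy (ltnW lt_ys) lt_ys leqnn fs => /(_ isT) ? /(_ isT) ?; lia.
  have [/sep->//|/sep->|->] := ltngtP p q; [by rewrite orbT | by rewrite eqxx].
have facetB : facet (Ind G) B.
  apply/maxsetP; split=> // C /Ind_circulantP CG BC; apply/eqP; rewrite eqEsubset BC andbT.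
  apply/subsetP => v Cv; apply/negPn/negP => vB.
  (* A discrete intermediate value argument places [v] in a gap of [B], which is too short for a
     vertex at distance above [d] from both ends. *)
  have crossing m : (m <= s)%N -> (v < f m)%N ->
      exists2 q, (q < s)%N & (f q <= v < f q.+1)%N.
    elim: m => [|q IHq] le_q; first by rewrite f0.
    have [lt_fv _|le_fv lt_v] := ltnP v (f q); first exact: IHq (ltnW le_q) lt_fv.
    by exists q; rewrite ?le_fv.
  have [|q lt_qs /andP[le_v lt_v]] := crossing s (leqnn s); first by rewrite fs.
  have far (x : 'I_s) : (v + d < f x) && (f x + d < v + n) || (f x + d < v) && (v + d < f x + n).
    have inB : Ordinal (f_lt x (ltn_ord x)) \in B by apply: imset_f.
    have := CG v _ Cv (subsetP BC _ inB); rewrite circulant_nonadjacent; apply.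
    by apply: contraNneq vB => ->.
  have [_ gap] := fS q lt_qs; have := far (Ordinal lt_qs) => /=.
  (* The last gap ends at [f s = n], that is, at the vertex 0. *)
  have [qs|ne_qs] := eqVneq q.+1 s.
    by have := far (Ordinal s_gt0); move: gap (ltn_ord v); rewrite /= qs fs f0; lia.
  have lt_qs' : (q.+1 < s)%N by rewrite ltn_neqAle ne_qs.
  have := far (Ordinal lt_qs'); move: gap (ltn_ord v) => /=; lia.
have [C /maxsetP[CG maxC] AC] : {C | maxset (mem (Ind G)) C & A \subset C} by apply: maxset_exists.
have facetC : facet (Ind G) C by apply/maxsetP.
have := pureG B C facetB facetC; have := subset_leq_card AC.
rewrite /face_dim cardA => le_C /addIr[eqBC].
by move: cardB; rewrite eqBC leqNgt le_C.
Qed.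

(** The only vertex not adjacent to [v] is its antipode [v + d + 1], so the complement is a perfect
    matching and vertex links are single points. *)
Lemma circulant_antipode_Buchsbaum : n = (2 * d + 2)%N -> Buchsbaum k G.
Proof.
move=> nE; have lt_dn : (d < n)%N by lia.
have le2 F : F \in Ind G -> (#|F| <= 2)%N.
  by move/(Ind_circulant_card lt_dn); case: #|F| => [|[|[|m]]] //; nia.
apply: Buchsbaum_of_connected_links => [|F /le2/leqW //|v a b].
  apply: (pure_of_extension le2) => F FG; rewrite ltnS leq_eqVlt.
  case/orP => [/cards1P[v ->]|]; last first.
    rewrite ltnS leqn0 cards_eq0 => /eqP->; have n_gt0 : (0 < n)%N by lia.
    by exists (Ordinal n_gt0); [rewrite inE | rewrite setU0 Ind1].
  have [|w vw] := @rotate n v d.+1; first by lia.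
  have adj : nonadjacent G w v.
    by rewrite circulant_nonadjacent; move: (ltn_ord v) (ltn_ord w); lia.
  by exists w; case/andP: adj => wv nG; [rewrite inE | rewrite Ind2].
rewrite !circulant_nonadjacent => va vb; rewrite (_ : a = b) //.
by apply: val_inj => /=; move: (ltn_ord v) (ltn_ord a) (ltn_ord b) va vb; lia.
Qed.

Lemma circulant_antipode_not_CM : n = (2 * d + 2)%N -> ~ CohenMacaulay k G.
Proof.
move=> nE CMG.
have lt0 : (0 < n)%N by lia.
have lt1 : (1 < n)%N by lia.
have ltd : (d.+1 < n)%N by lia.
pose o := Ordinal lt0; pose p := Ordinal ltd.
have op : nonadjacent G o p by rewrite circulant_nonadjacent /=; lia.
(* The indicator of the component of 0 in the complement; the vertex 1 lies outside it since [d] is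
   positive. *)
pose c (v : 'I_n) : k := if (v == o) || (v == p) then 1%R else 0%R.
have := nonedge2 op; rewrite inE => /andP[opG /eqP op2].
have := @CohenMacaulay_locally_constant k n G [set o; p] c CMG opG.
rewrite op2 => /(_ isT) cst; have : c o = c (Ordinal lt1).
  apply: cst => u v; rewrite circulant_nonadjacent /c -!val_eqE /= => uv.
  by congr (if _ then _ else _); move: (ltn_ord u) (ltn_ord v) uv; lia.
rewrite /c eqxx -!val_eqE /= eqSS [0 == d]eq_sym.
by rewrite -[d == 0]negbK -lt0n d_gt0 /= => /eqP; rewrite oner_eq0.
Qed.

(** * The two-dimensional case [n = 4 * d + 3] *)

Section FourDPlusThree.
Hypothesis nE : n = (4 * d + 3)%N.

Let lt_dn : (d < n)%N. Proof. by lia. Qed.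

Lemma circulant_4d3_card_le3 F : F \in Ind G -> (#|F| <= 3)%N.
Proof. by move/(Ind_circulant_card lt_dn); case: #|F| => [|[|[|[|m]]]] //; nia. Qed.

Lemma circulant_4d3_pure : pure (Ind G).
Proof.
apply: (pure_of_extension circulant_4d3_card_le3) => F FG.
have n_gt0 : (0 < n)%N by lia.
case F2 : #|F| => [|[|[|m]]] // _.
- move/eqP: F2; rewrite cards_eq0 => /eqP->.
  by exists (Ordinal n_gt0); [rewrite inE | rewrite setU0 Ind1].
- have /cards1P[v ->] : #|F| == 1 by rewrite F2.
  have [|w vw] := @rotate n v d.+1; first by lia.
  have : nonadjacent G w v.
    by rewrite circulant_nonadjacent; move: (ltn_ord v) (ltn_ord w); lia.
  by case/andP => wv nG; exists w; [rewrite inE | rewrite Ind2].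
have FE : F \in nonedges G by rewrite inE FG F2.
have [u [v [FuvE ne_uv nGuv]]] := nonedgesP FE.
(* One of the two arcs between [x] and [y] has length at least [2 * d + 2], and a third vertex fits
   into it at distance [d + 1] from its start. *)
have third (x y : 'I_n) : nonadjacent G x y -> (x < y)%N ->
    exists2 w, nonadjacent G w x & nonadjacent G w y.
  rewrite circulant_nonadjacent => xy lt_xy.
  have [far|near] := leqP (x + (2 * d + 2)) y.
    have [|w xw] := @rotate n x d.+1; first by lia.
    by exists w; rewrite circulant_nonadjacent; move: (ltn_ord x) (ltn_ord y) (ltn_ord w) xy; lia.
  have [|w yw] := @rotate n y d.+1; first by lia.
  by exists w; rewrite circulant_nonadjacent; move: (ltn_ord x) (ltn_ord y) (ltn_ord w) xy; lia.
have uv : nonadjacent G u v by rewrite /nonadjacent ne_uv.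
have [w wu wv] : exists2 w, nonadjacent G w u & nonadjacent G w v.
  have := ne_uv; rewrite -val_eqE neq_ltn => /orP[/(third _ _ uv) // |].
  by move: uv; rewrite nonadjacentC => vu /(third _ _ vu)[w]; exists w.
exists w; rewrite FuvE.
  by rewrite !inE negb_or; case/andP: wu => -> _; case/andP: wv.
have sym := @nonadjacentC n d.
apply/Ind_circulantP => x y; rewrite !inE => /or3P[]/eqP-> /or3P[]/eqP->; rewrite ?eqxx // => _;
  by rewrite // sym.
Qed.

Lemma circulant_4d3_links_connected v a b : nonadjacent G v a -> nonadjacent G v b ->
  connect (fun x y => [set x; y] \in link (Ind G) [set v]) a b.
Proof.
set e := fun x y => _.
have edge x y : nonadjacent G v x -> nonadjacent G v y -> nonadjacent G x y -> e x y.
  move=> vx vy xy; rewrite /e inE; have := nonedge2 xy; rewrite inE => /andP[-> _] /=.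
  have sym := @nonadjacentC n d.
  rewrite disjoints1 in_set2 negb_or; have /andP[-> _] := vx; have /andP[-> _] := vy.
  apply/Ind_circulantP => r s; rewrite !inE => /or3P[]/eqP-> /or3P[]/eqP->; rewrite ?eqxx // => _;
    by rewrite // sym.
have sym_e : connect_sym e by apply: sym_connect_sym => x y; rewrite /e setUC.
(* The vertices of the link of [v] run from [h = v + d + 1] to [h' = v + 3 * d + 2]. One within
   distance [d] of [h] is joined to [h'], and [h'] is joined to [h]. *)
have [|h vh] := @rotate n v d.+1; first by lia.
have [|h' vh'] := @rotate n v (3 * d + 2); first by lia.
have nv_h : nonadjacent G v h by rewrite circulant_nonadjacent; move: (ltn_ord v) (ltn_ord h); lia.
have nv_h' : nonadjacent G v h' by rewrite circulant_nonadjacent; move: (ltn_ord v) (ltn_ord h'); lia.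
have to_hub x : nonadjacent G v x -> connect e x h.
  move=> vx; have [xh|nxh] := boolP (nonadjacent G x h); first exact/connect1/edge.
  have [->//|ne_xh] := eqVneq x h.
  apply: (connect_trans (y := h')); apply/connect1/edge => //; move: vx nxh ne_xh;
    rewrite -?val_eqE !circulant_nonadjacent /=;
    move: (ltn_ord v) (ltn_ord x) (ltn_ord h) (ltn_ord h'); lia.
by move=> /to_hub ah /to_hub bh; apply: connect_trans ah _; rewrite sym_e.
Qed.

Lemma circulant_4d3_Buchsbaum : Buchsbaum k G.
Proof.
apply: Buchsbaum_of_connected_links.
- exact: circulant_4d3_pure.
- exact: circulant_4d3_card_le3.
- exact: circulant_4d3_links_connected.
Qed.

(* Orient each edge along its arc of length at most [2d+1].  Every triangle winds
   once around the cycle, so [1 - 3 * (crossings of 0)] is a cocycle; it takes the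
   value [5 - 3 * 2 = -1] on a closed walk with five steps winding twice. *)
Definition winding (u v : 'I_n) : k :=
  (if (u < v)%N then if (v <= u + (2 * d).+1)%N then 1 else 1 + 1
   else if (v < u)%N then if (u <= v + (2 * d).+1)%N then - 1 else - (1 + 1) else 0)%R.

Lemma circulant_4d3_not_CM : ~ CohenMacaulay k G.
Proof.
move=> CMG; have lt0 : (0 < n)%N by lia.
have lt_p (c : nat) : (c <= 4 * d + 2)%N -> (c < n)%N by lia.
have h1 : (d.+1 <= 4 * d + 2)%N by lia.
have h2 : (2 * d + 2 <= 4 * d + 2)%N by lia.
pose x := Ordinal lt0; pose y := Ordinal (lt_p _ h1); pose z := Ordinal (lt_p _ h2).
(* A face with gaps [d + 1], [d + 1] and [2 * d + 1], showing that the depth would have to be at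
   least 3. *)
have TG : [set x; y; z] \in Ind G.
  apply/Ind_circulantP => u v; rewrite !inE -!orbA.
  by move=> /or3P[]/eqP-> /or3P[]/eqP->; rewrite ?eqxx // circulant_nonadjacent /=; lia.
have T3 : #|[set x; y; z]| = 3.
  by rewrite setUC cardsU1 cards2 !inE -!val_eqE /=; lia.
have [|u|u v|u v w|psi psiE] := @CohenMacaulay_coboundary k n G _ winding CMG TG.
- by rewrite T3.
- by rewrite /winding ltnn.
- by rewrite /winding; case: ltngtP => _; rewrite ?oppr0 //; case: ifP; rewrite ?opprK.
- rewrite !circulant_nonadjacent /winding; move: (ltn_ord u) (ltn_ord v) (ltn_ord w).
  case: (ltngtP v w); case: (ltngtP u w); case: (ltngtP u v); try lia;
    do 3 (case: ifP); try lia; move=> *; ring.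
(* The closed walk visits 0, [2 * d + 1], [4 * d + 2], [2 * d], [3 * d + 1] and returns to 0. Its
   steps are three of length [2 * d + 1], one of [d + 1] and one of [d + 2], of total length
   [2 * n]. *)
have j1 : (2 * d + 1 <= 4 * d + 2)%N by lia.
have j2 : (2 * d <= 4 * d + 2)%N by lia.
have j3 : (3 * d + 1 <= 4 * d + 2)%N by lia.
pose a := Ordinal (lt_p _ j1); pose b := Ordinal (lt_p _ (leqnn _)).
pose c := Ordinal (lt_p _ j2); pose e := Ordinal (lt_p _ j3).
have xa : (1 = psi a - psi x)%R.
  by rewrite -psiE ?circulant_nonadjacent /winding /=; do ?case: ifP => //; lia.
have ab : (1 = psi b - psi a)%R.
  by rewrite -psiE ?circulant_nonadjacent /winding /=; do ?case: ifP => //; lia.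
have bc : (1 + 1 = psi b - psi c)%R.
  by rewrite -psiE ?circulant_nonadjacent /winding /=; do ?case: ifP => //; lia.
have ce : (1 = psi e - psi c)%R.
  by rewrite -psiE ?circulant_nonadjacent /winding /=; do ?case: ifP => //; lia.
have xe : (1 + 1 = psi e - psi x)%R.
  by rewrite -psiE ?circulant_nonadjacent /winding /=; do ?case: ifP => //; lia.
(* The differences of [psi] telescope to 0 around the walk, while their values give [4 - 3 = 1], in
   any characteristic. *)
have : (1 = 0 :> k)%R.
  transitivity ((psi b - psi c) + (psi e - psi x)
      - ((psi a - psi x) + (psi b - psi a) + (psi e - psi c)))%R; last by ring.
  by rewrite -bc -xe -xa -ab -ce; ring.
by move/eqP; rewrite oner_eq0.
Qed.
End FourDPlusThree.
End Cases.

Theorem theorem3p7 (k : fieldType) (n d : nat)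
    (hn : (2 * d <= n)%N) (hd : (1 <= d)%N) :
  (Buchsbaum k (circulant n (iota 1 d)) /\
   ~ CohenMacaulay k (circulant n (iota 1 d)))
  <-> (n = 2 * d + 2 \/ n = 4 * d + 3)%N.
Proof.
split=> [[[pureG _] nCM] | [nE|nE]].
- have [lt_n|le_n] := ltnP n (2 * d + 2); first by case: nCM; apply: circulant_complete_CM.
  have [->|ne_n] := eqVneq n (2 * d + 2); [by left | right].
  have [le_n'|lt_n] := leqP n (3 * d + 2).
    by case: nCM; apply: circulant_graph_CM; lia.
  have [//|/eqP ne_n'] := eqVneq n (4 * d + 3); exfalso.
  by apply: (circulant_not_pure hd) pureG => //; lia.
- by split; [apply: circulant_antipode_Buchsbaum | apply: circulant_antipode_not_CM].
- by split; [apply: circulant_4d3_Buchsbaum | apply: circulant_4d3_not_CM].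
Qed.
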